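(* Fix $\lambda>0$ and $a>0$, let $p_n=\lambda/n$, let $(k_n)_{n\in\mathbb N}$ be a sequence of positive reals with $\lim_{n\to\infty}k_n=\infty$, and put $\varepsilon_n=k_n^{-2/3}$. Suppose that $\lim_{n\to\infty}\varepsilon_n=0$. Let $(w_n)_{n\in\mathbb N}$ be a sequence of positive reals such that $\lim_{n\to\infty}w_n=0$, such that $w_nk_n\ge\binom n3 (p_n)^{C}$ for some constant $C>0$, such that $\lim_{n\to\infty}\frac{\log n}{w_n^2k_n^{1/3}}=0$, and such that $\lim_{n\to\infty}\frac{\log w_n}{\log(1/p_n)}=0$. Then there is a sequence $\psi_n=o(1)$ such that, for $n$ large enough, $$-(1+\varepsilon_n)\,\Phi_{n,p_n,k_n}(a+w_n)\le\log\mathbb P(T\ge a k_n)\le-(1-\psi_n)\,\Phi_{n,p_n,k_n}(a-w_n),$$ where, for $\lim_{n\to\infty}w_nk_n^{1/3}=\infty$ (and $n$ large enough), $$\tfrac12[6a(1-w_n)k_n]^{2/3}\log(1/p_n)\le\Phi_{n,p_n,k_n}(a)\le\tfrac12[6a(1+w_n)k_n]^{2/3}\log(1/p_n).$$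
   Context: $K_n$ is the complete graph on $[n]=\{1,\dots,n\}$. $G_{n,p}$ is the Erdős–Rényi random graph on $[n]$: each edge of $K_n$ is present independently with probability $p$; its law is $\mathbb P$ (here $p=p_n$). $T$ is the number of triangles in $G_{n,p}$. For a graph $G$ with $V(G)\subseteq[n]$, $e_G=|E(G)|$, $\mathbb P_G(\cdot)=\mathbb P(\cdot\mid G_{n,p}\supseteq G)$ is the law conditional on $G_{n,p}$ containing all edges of $G$, and $\mathbb E_G$ is the corresponding expectation. For $n\in\mathbb N$, $p\in(0,1)$ and $a,k>0$, $$\Phi_{n,p,k}(a):=\min\{e_G\log(1/p):\ G\subseteq K_n,\ \mathbb E_G(T)\ge ak\}.$$
   Formalization: The upper bound on Φ(a) in the last display is asserted only for those n where some G ⊆ K_n has E_G(T) ≥ a k_n; otherwise the minimum is over the empty set (taken as +∞) and that bound fails, e.g. for k_n = n^10, w_n = 1/log n. *)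

(* Defs.v *)
From mathcomp Require Import all_boot all_order all_algebra.
From mathcomp Require Import all_classical all_reals all_analysis.

Set Implicit Arguments.
Unset Strict Implicit.
Unset Printing Implicit Defensive.

Import Order.TTheory GRing.Theory Num.Theory.
Import numFieldNormedType.Exports.

Local Open Scope ring_scope.

(* A graph on [n] is given by its edge set, a set of two-element subsets of
   'I_n. Neither e_G nor conditioning on the edges of G sees isolated vertices,
   so edge sets G \subset complete_graph n stand for all subgraphs of K_n. *)
Definition edge_set (n : nat) := {set {set 'I_n}}.

Definition complete_graph (n : nat) : edge_set n := [set e : {set 'I_n} | #|e| == 2].

Definition triangles (n : nat) (H : edge_set n) : nat :=
  #|[set t : {set 'I_n} | (#|t| == 3) &&
      [forall (e : {set 'I_n} | (e \subset t) && (#|e| == 2)), e \in H]]|.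

Section ErdosRenyi.
Context {R : realType}.

Definition gnp_mass (n : nat) (p : R) (H : edge_set n) : R :=
  p ^+ #|H| * (1 - p) ^+ #|complete_graph n :\: H|.

Definition gnp (n : nat) (p : R) (A : {set edge_set n}) : R :=
  \sum_(H in A | H \subset complete_graph n) gnp_mass p H.

Definition contains (n : nat) (G : edge_set n) : {set edge_set n} :=
  [set H : edge_set n | G \subset H].

Definition gnp_cond (n : nat) (p : R) (G : edge_set n)
    (A : {set edge_set n}) : R :=
  gnp p (A :&: contains G) / gnp p (contains G).

Definition cond_mean_triangles (n : nat) (p : R) (G : edge_set n) : R :=
  \sum_(H : edge_set n) (triangles H)%:R * gnp_cond p G [set H].

Definition upper_tail (n : nat) (x : R) : {set edge_set n} :=
  [set H : edge_set n | x <= (triangles H)%:R].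

Definition feasible (n : nat) (p k a : R) : {set edge_set n} :=
  [set G : edge_set n | (G \subset complete_graph n) && (a * k <= cond_mean_triangles p G)].

(* The minimum over the empty set is +oo; this occurs when a * k exceeds the
   number of triangles of K_n. *)
Definition Phi (n : nat) (p k a : R) : \bar R :=
  \big[mine/+oo%E]_(G in feasible n p k a) (#|G|%:R * ln p^-1)%:E.

End ErdosRenyi.

(* Main.v *)
Require Import Defs.
From mathcomp Require Import all_boot all_order all_algebra.
From mathcomp Require Import all_classical all_reals all_analysis.
From mathcomp Require Import zify ring lra.

(* Write S(G) = \sum_t p^(number of edges of t outside G), the sum being over the
   triangles t of K_n; this is E_G(T). As n p = lambda, a triangle with an edge in
   G but not contained in G costs a factor p, so T(G) <= S(G) <= T(G) + lambda e_G
   + lambda^3. With c = (6 a k)^(1/3), the bound (6 T(G))^2 <= (2 e_G)^3 shows that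
   Phi(a) is at least about (c^2 / 2) log(1/p), and cliques show that this is sharp.

   Lower tail bound: a minimiser G of Phi(a + w) has a k triangles on its own, and
   it is contained in the random graph with probability p^(e_G).

   Upper tail bound: call U a seed if it has at most L = 3 l edges, l of order
   c^2 log n, and nearly a k triangles. If S(U) <= y for every small U that is not
   a seed, then, expanding T one triangle at a time, the l-th moment of T on the
   event that there is no seed is at most y^l; as y < a k this makes
   {T >= a k, no seed} negligible. A seed contains a core, of nearly as many
   triangles, in which every edge lies in at least D triangles, D of order
   c / log n. The degrees in a core with m edges are at least D, so it spans at
   most 2 m / D vertices, and there are at most n^(2m/D) (C m / D^2)^m = n^(o(m))
   such cores, each present with probability p^m. A union bound concludes, because
   m is at least about c^2 / 2. *)

Set Implicit Arguments.
Unset Strict Implicit.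
Unset Printing Implicit Defensive.

Import Order.TTheory GRing.Theory Num.Theory.
Import numFieldNormedType.Exports.

Local Open Scope ring_scope.

(** * Counting triangles and cores *)

Lemma leq_ffact_exp (n m : nat) : (n ^_ m <= n ^ m)%N.
Proof.
by elim: m => [|m IH]; rewrite ?ffactn0// ffactnSr expnSr leq_mul// leq_subr.
Qed.

Section TriangleCounts.
Variable n : nat.
Implicit Types (t e : {set 'I_n}) (U W H G : edge_set n) (x y : 'I_n).

Definition triples : {set {set 'I_n}} := [set t : {set 'I_n} | #|t| == 3].

Definition pairs (t : {set 'I_n}) : edge_set n :=
  [set e : {set 'I_n} | e \subset t & #|e| == 2].

Lemma card_pairs t : #|pairs t| = 'C(#|t|, 2).
Proof. exact: cards_draws. Qed.

Lemma pairs_complete t : pairs t \subset complete_graph n.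
Proof. by apply/fintype.subsetP => e; rewrite !inE => /andP[]. Qed.

Lemma trianglesE H : triangles H = #|[set t in triples | pairs t \subset H]|.
Proof.
apply: eq_card => t; rewrite !inE; congr (_ && _).
apply/forall_inP/fintype.subsetP => [h e|h e eP]; first by rewrite inE; exact: h.
by apply: h; rewrite inE.
Qed.

Lemma triangles_mono H W : H \subset W -> (triangles H <= triangles W)%N.
Proof.
move=> HW; rewrite !trianglesE; apply/subset_leq_card/fintype.subsetP => t.
by rewrite !inE => /andP[-> /=] tH; exact: fintype.subset_trans tH HW.
Qed.

Lemma triangles_complete : triangles (complete_graph n) = 'C(n, 3).
Proof.
rewrite trianglesE -[n in RHS]card_ord -card_draws; apply: eq_card => t.
by rewrite !inE pairs_complete andbT.
Qed.

Lemma triangles_le_bin H : H \subset complete_graph n -> (triangles H <= 'C(n, 3))%N.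
Proof. by rewrite -triangles_complete; exact: triangles_mono. Qed.

Definition degree U x : nat := #|[set e in U | x \in e]|.

Lemma sum_degree U : U \subset complete_graph n ->
  (\sum_x degree U x = 2 * #|U|)%N.
Proof.
move=> UK.
have -> : (\sum_x degree U x = \sum_x \sum_(e in U) (x \in e))%N.
  apply: eq_bigr => x _; rewrite /degree -sum1_card [RHS]big_mkcond /=.
  rewrite big_mkcond /=; apply: eq_bigr => e _; rewrite inE.
  by case: (e \in U) => //=; case: (x \in e).
rewrite exchange_big /= mulnC -sum_nat_const; apply: eq_bigr => e eU.
rewrite -big_mkcond /= sum1_card.
by move/fintype.subsetP: UK => /(_ e eU); rewrite inE => /eqP.
Qed.

Lemma sum_triangles_at U :
  (\sum_x #|[set t in triples | (pairs t \subset U) && (x \in t)]|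
   = 3 * triangles U)%N.
Proof.
rewrite trianglesE.
have -> : (\sum_x #|[set t in triples | (pairs t \subset U) && (x \in t)]|
   = \sum_x \sum_(t in [set t in triples | pairs t \subset U]) (x \in t))%N.
  apply: eq_bigr => x _; rewrite -sum1_card [RHS]big_mkcond /=.
  rewrite big_mkcond /=; apply: eq_bigr => t _; rewrite !inE.
  by case: (#|t| == _) => //=; case: (pairs t \subset U) => //=; case: (x \in t).
rewrite exchange_big /= mulnC -sum_nat_const; apply: eq_bigr => t.
by rewrite !inE => /andP[/eqP t3 _]; rewrite -big_mkcond /= sum1_card.
Qed.

(* A triangle at [x] is an edge spanned by the neighbours of [x]: their number
   is at most |U|, and at most half the squared degree. *)
Lemma triangles_at_sq U x :
  (2 * #|[set t in triples | (pairs t \subset U) && (x \in t)]| ^ 2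
   <= degree U x ^ 2 * #|U|)%N.
Proof.
set S := [set t in _ | _]; pose N := [set y : 'I_n | (y != x) && ([set x; y] \in U)].
have Sinj : {in S &, injective (fun t => t :\ x)}.
  move=> t t'; rewrite !inE => /and3P[_ _ xt] /and3P[_ _ xt'] E.
  by rewrite -(finset.setD1K xt) -(finset.setD1K xt') E.
have SP t : t \in S -> t :\ x \in pairs t /\ t :\ x \subset N.
  rewrite !inE => /and3P[/eqP t3 tU xt].
  have c2 : #|t :\ x| = 2%N by move: (cardsD1 x t); rewrite xt t3 => -[].
  rewrite finset.subsetDl c2; split=> //; apply/fintype.subsetP => y.
  rewrite !inE => /andP[yx yt]; rewrite yx /=; apply: (fintype.subsetP tU).
  rewrite inE cards2 (eq_sym x) yx eqxx andbT; apply/fintype.subsetP => z.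
  by rewrite !inE => /orP[] /eqP ->.
have S_U : (#|S| <= #|U|)%N.
  rewrite -(card_in_imset Sinj); apply/subset_leq_card/fintype.subsetP => _ /finset.imsetP[t tS ->].
  have [tt _] := SP _ tS; move: tS; rewrite !inE => /and3P[_ + _].
  by move/fintype.subsetP; apply.
have N_d : (#|N| <= degree U x)%N.
  rewrite -(@card_in_imset _ _ (fun y => [set x; y]) (mem N)).
    apply/subset_leq_card/fintype.subsetP => _ /finset.imsetP[y + ->].
    by rewrite !inE => /andP[_ ->]; rewrite eqxx.
  move=> y z; rewrite !inE => /andP[yx _] /andP[zx _] /finset.setP /(_ y).
  by rewrite !inE eqxx orbT (negbTE yx) /= => /esym/eqP.
have S_N : (#|S| <= 'C(#|N|, 2))%N.
  rewrite -(card_in_imset Sinj) -cards_draws.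
  apply/subset_leq_card/fintype.subsetP => _ /finset.imsetP[t tS ->].
  have [tt tN] := SP _ tS; rewrite inE tN /=.
  by move: tt; rewrite inE => /andP[].
have S_d : (2 * #|S| <= degree U x ^ 2)%N.
  apply: leq_trans (_ : #|N| ^ 2 <= _)%N; last by rewrite leq_exp2r.
  apply: leq_trans (leq_mul (leqnn 2) S_N) _.
  by rewrite mul2n -[X in (X <= _)%N]/('C(_, 2).*2) bin2 -mul2n; nia.
by rewrite expnS expn1 mulnA leq_mul.
Qed.

(** By [triangles_at_sq], the count at [x] is at most [degree U x] times the square root of |U| / 2.
    Summing over [x] gives 3 T(U) against a degree sum of 2 |U|; multiplying the bounds of two
    vertices avoids the roots. *)
Lemma triangles_sq U : U \subset complete_graph n ->
  (9 * triangles U ^ 2 <= 2 * #|U| ^ 3)%N.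
Proof.
move=> UK.
pose T x := #|[set t in triples | (pairs t \subset U) && (x \in t)]|.
have TT x y : (2 * (T x * T y) <= degree U x * degree U y * #|U|)%N.
  rewrite -leq_sqr.
  have := leq_mul (triangles_at_sq U x) (triangles_at_sq U y).
  by rewrite -/(T x) -/(T y); set dx := degree _ _; set dy := degree _ _; nia.
have : (2 * (\sum_x T x) ^ 2 <= (\sum_x degree U x) ^ 2 * #|U|)%N.
  rewrite -!mulnn !big_distrlr /= big_distrr big_distrl /=; apply: leq_sum => x _.
  by rewrite big_distrr big_distrl /=; apply: leq_sum => y _; exact: TT.
rewrite sum_degree// sum_triangles_at; nia.
Qed.

Definition triangles_on U e : nat :=
  #|[set t in triples | (pairs t \subset U) && (e \subset t)]|.

Lemma triangles_setD1 U e : (#|e| = 2)%N ->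
  (triangles U <= triangles (U :\ e) + triangles_on U e)%N.
Proof.
move=> e2; rewrite !trianglesE /triangles_on.
apply: leq_trans (leq_card_setU _ _); apply/subset_leq_card/fintype.subsetP => t.
rewrite !inE => /andP[-> tU] /=; rewrite tU /=; case: (boolP (e \subset t)) => et.
  by rewrite orbT.
rewrite orbF finset.subsetD1 tU /= inE e2 eqxx andbT; exact: et.
Qed.

Definition is_core (D : nat) W : bool :=
  [forall (e | e \in W), (D <= triangles_on W e)%N].

Lemma exists_core (D : nat) U : U \subset complete_graph n ->
  exists W, [/\ W \subset U, is_core D W &
    (triangles U <= triangles W + D * #|U|)%N].
Proof.
move=> UK.
(* deleting an edge in fewer than [D] triangles would increase this potential *)
pose f W := (triangles W + D * (#|U| - #|W|))%N.
have [W WU Wmax] := @arg_maxnP _ U (fun W : {set {set 'I_n}} => W \subset U) f (subxx U).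
exists W; split=> //.
  apply/forall_inP => e eW; rewrite leqNgt; apply/negP => lD.
  have W'U : W :\ e \subset U by apply: fintype.subset_trans WU; exact: finset.subsetDl.
  have e2 : #|e| = 2%N.
    by move/fintype.subsetP: UK => /(_ e (fintype.subsetP WU e eW)); rewrite inE => /eqP.
  have lossW := triangles_setD1 W e2; have cWU := subset_leq_card WU.
  have fW : (f (W :\ e) <= f W)%N := Wmax _ W'U; move: fW; rewrite /f.
  have -> : (#|U| - #|W :\ e| = (#|U| - #|W|).+1)%N.
    by move: cWU; rewrite (cardsD1 e W) eW; lia.
  rewrite mulnS; move: lossW lD; set TW := triangles _; set TW' := triangles _.
  by set Te := triangles_on _ _; set q := muln _ _; lia.
have fU : (f U <= f W)%N := Wmax _ (subxx U); move: fU; rewrite /f subnn muln0 addn0.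
by move=> /leq_trans; apply; rewrite leq_add2l leq_mul2l leq_subr orbT.
Qed.

(** With e = {x, y}, removing [y] from a triangle through [e] leaves an edge at [x], and distinct
    triangles leave distinct edges. *)
Lemma core_degree (D : nat) W e x : (#|e| = 2)%N -> is_core D W -> e \in W ->
  x \in e -> (D <= degree W x)%N.
Proof.
move=> e2 /forall_inP cW eW xe; apply: leq_trans (cW e eW) _.
have [y yE ye] : exists2 y, e = [set x; y] & y != x.
  have /cards1P[y E] : #|e :\ x| == 1%N.
    by apply/eqP; move: (cardsD1 x e); rewrite xe e2 => -[].
  exists y; first by rewrite -(finset.setD1K xe) E.
  by have : y \in e :\ x; [rewrite E !inE | rewrite !inE => /andP[]].
rewrite /triangles_on /degree -(@card_in_imset _ _ (fun t => t :\ y)).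
  apply/subset_leq_card/fintype.subsetP => _ /finset.imsetP[t + ->].
  rewrite yE !inE => /and3P[/eqP t3 tU et].
  have yt : y \in t by apply: (fintype.subsetP et); rewrite !inE eqxx orbT.
  have xt : x \in t by apply: (fintype.subsetP et); rewrite !inE eqxx.
  rewrite eq_sym ye xt /= andbT; apply: (fintype.subsetP tU).
  rewrite inE finset.subsetDl /=; apply/eqP.
  by move: (cardsD1 y t); rewrite yt t3 => -[].
move=> t t'; rewrite !inE yE => /and3P[_ _ et] /and3P[_ _ et'] E.
have yt : y \in t by apply: (fintype.subsetP et); rewrite !inE eqxx orbT.
have yt' : y \in t' by apply: (fintype.subsetP et'); rewrite !inE eqxx orbT.
by rewrite -(finset.setD1K yt) -(finset.setD1K yt') E.
Qed.

(** [finset.cover W] is the set of vertices that [W] meets; each has degree at least [D], and the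
    degrees sum to 2 |W|. *)
Lemma core_cover (D : nat) W : W \subset complete_graph n -> is_core D W ->
  (#|finset.cover W| * D <= 2 * #|W|)%N.
Proof.
move=> WK cW; rewrite -sum_degree// -sum_nat_const.
rewrite [X in (_ <= X)%N](bigID (mem (finset.cover W))) /=; apply: leq_trans (leq_addr _ _).
apply: leq_sum => x; move=> /finset.bigcupP[e eW xe]; apply: (core_degree _ cW eW xe).
by move/fintype.subsetP: WK => /(_ e eW); rewrite inE => /eqP.
Qed.

(** A map from ['I_V] names the vertices, in n^V ways; the [m] edges are then chosen among the
    images of the V^2 pairs of indices. *)
Lemma card_cores (D m V : nat) : (0 < n)%N -> (0 < D)%N -> (2 * m <= V * D + D.-1)%N ->
  (#|[set W : edge_set n | [&& W \subset complete_graph n, is_core D W & #|W| == m]]|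
   <= n ^ V * 'C(V * V, m))%N.
Proof.
move=> n0 D0 mV.
pose img (f : {ffun 'I_V -> 'I_n}) : edge_set n :=
  [set [set f ij.1; f ij.2] | ij : 'I_V * 'I_V].
pose X f := [set W : edge_set n | W \subset img f & #|W| == m].
apply: leq_trans (_ : #|\bigcup_(f : {ffun 'I_V -> 'I_n}) X f| <= _)%N.
  apply/subset_leq_card/fintype.subsetP => W; rewrite inE => /and3P[WK cW Wm].
  (* The term [D.-1] lets [V] be the floor of 2m / D: since 2m < (V + 1) D, there are fewer than V +
     1 vertices. *)
  have cV : (#|finset.cover W| <= V)%N.
    have := core_cover WK cW; rewrite (eqP Wm) => cD.
    rewrite -ltnS -(ltn_pmul2r D0); apply: leq_ltn_trans cD _.
    by rewrite mulSn; lia.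
  (* Surplus indices are sent to [x0]; for an empty core any constant map will do. *)
  have [f fP] : exists f : {ffun 'I_V -> 'I_n}, {subset finset.cover W <= codom f}.
    case: (pickP (mem (finset.cover W))) => [x0 x0W|W0]; last first.
      exists [ffun=> Ordinal n0] => x.
      by rewrite -[x \in finset.cover W]/(mem (finset.cover W) x) W0.
    exists [ffun i : 'I_V => nth x0 (enum (finset.cover W)) i] => x xW.
    have xi : (index x (enum (finset.cover W)) < V)%N.
      by apply: leq_trans cV; rewrite cardE index_mem mem_enum.
    apply/codomP; exists (Ordinal xi); rewrite ffunE /= nth_index//.
    by rewrite mem_enum.
  apply/finset.bigcupP; exists f => //; rewrite inE Wm andbT; apply/fintype.subsetP => e eW.
  move/fintype.subsetP: WK => /(_ e eW); rewrite inE => /cards2P[x [y [xy eE]]].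
  have xW : x \in finset.cover W by apply/finset.bigcupP; exists e; rewrite // eE !inE eqxx.
  have yW : y \in finset.cover W by apply/finset.bigcupP; exists e; rewrite // eE !inE eqxx orbT.
  have /codomP[i iE] := fP _ xW; have /codomP[j jE] := fP _ yW.
  by apply/finset.imsetP; exists (i, j) => //=; rewrite eE iE jE.
apply: leq_trans (_ : \sum_f #|X f| <= _)%N.
  elim/big_ind2 : _ => [|A1 k1 A2 k2 h1 h2|//]; first by rewrite cards0.
  exact: leq_trans (leq_card_setU _ _) (leq_add h1 h2).
apply: leq_trans (_ : \sum_(f : {ffun 'I_V -> 'I_n}) 'C(V * V, m) <= _)%N.
  apply: leq_sum => f _; rewrite cards_draws; apply: leq_bin2l.
  by apply: leq_trans (leq_imset_card _ _) _; rewrite card_prod card_ord.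
by rewrite sum_nat_const card_ffun !card_ord.
Qed.

End TriangleCounts.

(** * The random graph *)

Section RandomGraph.
Variables (R : realType) (n : nat).
Implicit Types (p : R) (t e : {set 'I_n}) (U W H G : edge_set n) (x y : 'I_n).
Implicit Types A B : {set edge_set n}.

Local Notation K := (complete_graph n).

Lemma card_setU_setD U W : #|U :|: W| = (#|U| + #|W :\: U|)%N.
Proof.
rewrite cardsU cardsD [U :&: W]finset.setIC addnBA //.
by apply/subset_leq_card/finset.subsetIl.
Qed.

(** Expand the product of [F e + F' e] into a sum over edge sets H, taking [F] on H and [F'] off H.
    As [F] vanishes off [K] and [F'] on [G], only the H between [G] and [K] survive, each with its
    mass. *)
Lemma gnp_contains p G : G \subset K -> gnp p (contains G) = p ^+ #|G|.
Proof.
move=> GK.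
pose F e : R := if e \in K then p else 0.
pose F' e : R := if e \in G then 0 else if e \in K then 1 - p else 1.
transitivity (\prod_e (F e + F' e)); last first.
  rewrite (bigID (mem G)) /= [X in _ * X]big1 ?mulr1 => [|e eG]; last first.
    by rewrite /F /F' (negbTE eG); case: ifP => _; rewrite ?add0r// addrC subrK.
  rewrite -prodr_const; apply: eq_bigr => e eG.
  by rewrite /F /F' eG (fintype.subsetP GK e eG) addr0.
rewrite bigA_distr /gnp [LHS]big_mkcond /=; apply: eq_bigr => H _.
rewrite inE; case: ifP => [/andP[GH HK]|].
  rewrite (bigID (mem H)) /= /gnp_mass; congr (_ * _).
    rewrite -prodr_const; apply: eq_bigr => e eH.
    by rewrite eH /F (fintype.subsetP HK e eH).
  rewrite (bigID (mem K)) /= [X in _ = _ * X]big1 ?mulr1 => [|e /andP[eH eK]].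
    rewrite -prodr_const; apply: eq_big => [e|e]; rewrite !inE ?andbT//.
    move=> /andP[eH eK]; rewrite (negbTE eH) /F' inE eK ifN//.
    by apply: contra eH; exact: fintype.subsetP GH e.
  rewrite (negbTE eH) /F' (negbTE eK) ifN//.
  by apply: contra eH; exact: fintype.subsetP GH e.
move/negbT; rewrite negb_and => /orP[|] /subsetPn[e e1 e2].
  by rewrite (bigD1 e) //= (negbTE e2) /F' e1 mul0r.
by rewrite (bigD1 e) //= e1 /F (negbTE e2) mul0r.
Qed.

Section Nonneg.
Variables (p : R) (p01 : 0 < p < 1).

Lemma gnp_mass_ge0 H : 0 <= gnp_mass p H.
Proof.
case/andP: p01 => p0 p1.
by rewrite /gnp_mass mulr_ge0 ?exprn_ge0 ?subr_ge0 ?ltW.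
Qed.

Lemma gnp_ge0 A : 0 <= gnp p A.
Proof. by apply: sumr_ge0 => H _; exact: gnp_mass_ge0. Qed.

Lemma gnp_mono A B : (forall H, H \subset K -> H \in A -> H \in B) -> gnp p A <= gnp p B.
Proof.
move=> AB; rewrite /gnp big_mkcond [leRHS]big_mkcond; apply: ler_sum => H _.
case: ifP => [/andP[HA HK]|_]; first by rewrite AB// HK.
by case: ifP => // _; exact: gnp_mass_ge0.
Qed.

Lemma gnpU A B : gnp p (A :|: B) <= gnp p A + gnp p B.
Proof.
rewrite /gnp big_mkcond [X in _ <= X + _]big_mkcond [X in _ <= _ + X]big_mkcond /=.
rewrite -big_split; apply: ler_sum => H _ /=; rewrite inE.
have := gnp_mass_ge0 H.
by case: (H \in A); case: (H \in B); case: (H \subset K) => /=; lra.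
Qed.

Lemma gnp_exists (C : {set edge_set n}) : (forall W, W \in C -> W \subset K) ->
  gnp p [set H : edge_set n | [exists (W | W \in C), W \subset H]] <= \sum_(W in C) p ^+ #|W|.
Proof.
move=> CK; have -> : \sum_(W in C) p ^+ #|W| =
    \sum_(H : edge_set n) \sum_(W in C) if (W \subset H) && (H \subset K) then gnp_mass p H else 0.
  rewrite exchange_big /=; apply: eq_bigr => W /CK WK.
  rewrite -gnp_contains// /gnp big_mkcond /=; apply: eq_bigr => H _.
  by rewrite inE.
have mass0 := gnp_mass_ge0; rewrite /gnp big_mkcond; apply: ler_sum => H _.
rewrite inE; case: ifP => [/andP[/exists_inP[W WC WH] HK]|_]; last first.
  by apply: sumr_ge0 => W _; case: ifP.
rewrite (bigD1 W WC) /= WH HK lerDl.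
by apply: sumr_ge0 => V _; case: ifP.
Qed.

End Nonneg.

(** The sum S(U) of the overview. *)
Definition weight p U : R := \sum_(t in triples n) p ^+ #|pairs t :\: U|.

Lemma triangles_sum H :
  (triangles H)%:R = \sum_(t in triples n) (pairs t \subset H)%:R :> R.
Proof.
rewrite trianglesE -sum1_card natr_sum big_mkcond [RHS]big_mkcond /=.
by apply: eq_bigr => t _; rewrite !inE; case: (#|t| == _) => //=; case: (pairs t \subset H).
Qed.

(** By linearity: given [G], the triple [t] is a triangle with probability p^|G :|: pairs t| /
    p^|G|. *)
Lemma cond_mean_weight p G : 0 < p < 1 -> G \subset K ->
  cond_mean_triangles p G = weight p G.
Proof.
move=> /andP[p0 p1] GK; rewrite /cond_mean_triangles.
have single H : gnp p ([set H] :&: contains G) =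
    if (G \subset H) && (H \subset K) then gnp_mass p H else 0.
  rewrite /gnp big_mkcond (bigD1 H)//= big1 ?addr0 ?inE ?eqxx//= => H' HH'.
  by rewrite !inE (negbTE HH').
transitivity (\sum_(H : edge_set n) \sum_(t in triples n)
    (if [&& pairs t \subset H, G \subset H & H \subset K]
     then gnp_mass p H / p ^+ #|G| else 0)).
  apply: eq_bigr => H _.
  rewrite /gnp_cond gnp_contains// single triangles_sum mulr_suml; apply: eq_bigr => t _.
  case: (pairs t \subset H) => /=; last by rewrite mul0r.
  by rewrite mul1r; case: ifP; rewrite ?mul0r.
rewrite exchange_big /=; apply: eq_bigr => t _.
have UK : G :|: pairs t \subset K by rewrite finset.subUset GK pairs_complete.
rewrite -big_mkcond /= -mulr_suml.
transitivity (gnp p (contains (G :|: pairs t)) / p ^+ #|G|).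
  congr (_ / _); apply: eq_bigl => H; rewrite inE finset.subUset.
  by case: (pairs t \subset H); case: (G \subset H).
by rewrite gnp_contains// card_setU_setD exprD mulrC mulKf// expf_neq0// gt_eqF.
Qed.

Lemma weight_ge p U : 0 < p < 1 -> (triangles U)%:R <= weight p U.
Proof.
move=> /andP[p0 p1]; rewrite triangles_sum; apply: ler_sum => t _.
case: (boolP (_ \subset _)) => [tU|_]; last by rewrite exprn_ge0// ltW.
by move: tU; rewrite -finset.setD_eq0 => /eqP ->; rewrite cards0.
Qed.

Lemma weight_le_bin p U : 0 < p < 1 -> weight p U <= 'C(n, 3)%:R.
Proof.
move=> /andP[p0 p1]; rewrite -[n in leRHS]card_ord -card_draws -sumr_const.
by apply: ler_sum => t _; rewrite exprn_ile1// ltW.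
Qed.

(** Such a triple is an edge of [U] together with one more vertex. *)
Lemma card_triples_meeting U : U \subset K ->
  (#|[set t in triples n | pairs t :&: U != finset.set0]| <= #|U| * n)%N.
Proof.
move=> UK; rewrite -[X in (_ * X)%N]card_ord -[X in (_ * X)%N]cardsT -cardsX.
apply: leq_trans (leq_imset_card (fun ex => ex.2 |: ex.1) _).
apply/subset_leq_card/fintype.subsetP => t; rewrite !inE => /andP[/eqP t3].
case/set0Pn => e; rewrite !inE => /andP[/andP[et /eqP e2] eU].
have /cards1P[x xE] : #|t :\: e| == 1%N.
  by rewrite cardsD (finset.setIidPr et) t3 e2.
apply/finset.imsetP; exists (e, x); first by rewrite !inE eU.
by rewrite /= -xE finset.setUC -{1}(finset.setID t e) (finset.setIidPr et).
Qed.

Lemma weight_le p U : 0 < p < 1 -> U \subset K ->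
  weight p U <= (triangles U)%:R + (n%:R * p) * #|U|%:R + (n%:R * p) ^+ 3.
Proof.
move=> /andP[p0 p1] UK.
(* Triples inside [U] weigh 1; those sharing an edge with [U], at most n |U| of them, weigh at most
   [p]; the remaining ones, at most n^3, weigh p^3. *)
have tB t : t \in triples n -> p ^+ #|pairs t :\: U| <=
    (pairs t \subset U)%:R + p * (pairs t :&: U != finset.set0)%:R + p ^+ 3.
  rewrite inE => /eqP t3.
  have p3 : 0 <= p ^+ 3 by rewrite exprn_ge0// ltW.
  case: (boolP (_ \subset _)) => [tU|tU].
    move: tU; rewrite -finset.setD_eq0 => /eqP ->; rewrite cards0 expr0.
    by rewrite -addrA lerDl addr_ge0// mulr_ge0// ltW.
  rewrite add0r; case: eqP => [tU0|_] /=.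
    by rewrite mulr0 add0r cardsD tU0 cards0 subn0 card_pairs t3.
  rewrite mulr1 ler_wpDr// -[leRHS]expr1; apply: ler_wiXn2l; rewrite ?ltW//.
  by rewrite card_gt0 finset.setD_eq0.
apply: le_trans (ler_sum _ tB) _; rewrite !big_split /= -triangles_sum -!addrA lerD2l.
apply: lerD.
  have -> : n%:R * p * #|U|%:R = p * (#|U| * n)%:R by rewrite natrM; ring.
  rewrite -mulr_sumr; apply: ler_wpM2l; first exact: ltW.
  apply: le_trans (_ : (#|[set t in triples n | pairs t :&: U != finset.set0]|)%:R <= _).
    rewrite -sum1_card natr_sum big_mkcond [leRHS]big_mkcond /=.
    by apply: ler_sum => t _; rewrite !inE; case: (#|t| == _) => //=; case: (_ != _).
  by rewrite ler_nat card_triples_meeting.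
rewrite sumr_const exprMn -[leLHS]mulr_natl; apply: ler_wpM2r; first by rewrite exprn_ge0// ltW.
rewrite -natrX ler_nat card_draws card_ord.
by apply: leq_trans (leq_ffact_exp _ _); rewrite -bin_ffact leq_pmulr.
Qed.

End RandomGraph.

(** * Moments in the absence of seeds, and the union bound over cores *)

Section UpperTail.
Variables (R : realType) (n : nat) (p : R) (p01 : 0 < p < 1).
Implicit Types (t e : {set 'I_n}) (U W H G : edge_set n).

Local Notation K := (complete_graph n).

Let p_gt0 : 0 < p. Proof. by case/andP: p01. Qed.
Let p_lt1 : p < 1. Proof. by case/andP: p01. Qed.

Definition has_seed (L : nat) (x : R) H : bool :=
  [exists U : edge_set n, [&& U \subset H, (#|U| <= L)%N & x <= (triangles U)%:R]].

(* The factor [T] of the next moment, expanded over the triangles [t], turns the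
   condition that [H] contains [U] into the same condition for [U :|: pairs t]. *)
Definition seedless_moment (L : nat) (x : R) (i : nat) U : R :=
  \sum_(H : edge_set n | (U \subset H) && (H \subset K))
    gnp_mass p H * (triangles H)%:R ^+ i * (~~ has_seed L x H)%:R.

(** Induction on [i]: the moment of order i + 1 at [U] is the sum over [t] of those of order [i] at
    [U :|: pairs t], at most y^i p^|U| S(U). Each step adds at most three edges, whence the budget
    |U| + 3i. *)
Lemma seedless_moment_le (L : nat) (x y : R) : 0 <= y ->
  (forall U, U \subset K -> (#|U| <= L)%N -> (triangles U)%:R < x -> weight p U <= y) ->
  forall i U, U \subset K -> (#|U| + 3 * i <= L)%N ->
  seedless_moment L x i U <= y ^+ i * p ^+ #|U|.
Proof.
move=> y0 wy; elim=> [|i IH] U UK UL.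
  rewrite expr0 mul1r -gnp_contains// /gnp /seedless_moment.
  rewrite [leRHS](eq_bigl (fun H => (U \subset H) && (H \subset K))); last first.
    by move=> H; rewrite inE.
  apply: ler_sum => H _; rewrite expr0 mulr1 -[leRHS]mulr1.
  by rewrite ler_wpM2l ?(gnp_mass_ge0 p01)//; case: has_seed; rewrite ?ler01.
have UL' : (#|U| <= L)%N by apply: leq_trans UL; rewrite leq_addr.
(* If [U] is itself a seed, every H containing it has a seed and the moment vanishes; otherwise [wy]
   bounds S(U). *)
case: (lerP x (triangles U)%:R) => xU.
  rewrite /seedless_moment big1 ?mulr_ge0 ?exprn_ge0 ?(ltW p_gt0)//.
  move=> H /andP[UH _]; have -> : has_seed L x H; last by rewrite mulr0.
  by apply/existsP; exists U; rewrite UH UL' xU.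
have -> : seedless_moment L x i.+1 U =
    \sum_(t in triples n) seedless_moment L x i (U :|: pairs t).
  rewrite /seedless_moment.
  rewrite (exchange_big_dep (fun H => (U \subset H) && (H \subset K)))/=; last first.
    by move=> t H _; rewrite finset.subUset -andbA => /and3P[-> _ ->].
  apply: eq_bigr => H /andP[UH HK].
  rewrite exprSr {2}triangles_sum mulrA mulr_sumr mulr_suml.
  rewrite big_mkcond [RHS]big_mkcond /=; apply: eq_bigr => t _.
  rewrite finset.subUset UH HK andbT /=.
  by case: (t \in _) => //=; case: (_ \subset _); rewrite /= ?mulr1// mulr0 mul0r.
apply: le_trans (_ : \sum_(t in triples n) y ^+ i * p ^+ #|U :|: pairs t| <= _).
  apply: ler_sum => t; rewrite inE => /eqP t3; apply: IH.
    by rewrite finset.subUset UK pairs_complete.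
  apply: leq_trans UL; rewrite mulnS addnA leq_add2r.
  by apply: leq_trans (leq_card_setU _ _) _; rewrite leq_add2l card_pairs t3.
rewrite (eq_bigr (fun t => y ^+ i * p ^+ #|U| * p ^+ #|pairs t :\: U|)); last first.
  by move=> t _; rewrite card_setU_setD exprD mulrA.
rewrite -mulr_sumr -/(weight p U) exprSr [leRHS]mulrAC.
by rewrite ler_wpM2l ?wy// mulr_ge0 ?exprn_ge0// ltW.
Qed.

(** Markov's inequality for the [l]-th moment, at the empty edge set. *)
Lemma seedless_tail_le (l : nat) (x y z : R) : 0 <= y -> 0 < z ->
  (forall U, U \subset K -> (#|U| <= 3 * l)%N -> (triangles U)%:R < x -> weight p U <= y) ->
  gnp p [set H in upper_tail n z | ~~ has_seed (3 * l) x H] <= (y / z) ^+ l.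
Proof.
move=> y0 z0 wy; rewrite expr_div_n ler_pdivlMr ?exprn_gt0//.
have := @seedless_moment_le _ x _ y0 wy l finset.set0 (finset.sub0set _).
rewrite cards0 add0n expr0 mulr1 leqnn => /(_ isT); apply: le_trans.
rewrite /gnp /seedless_moment mulr_suml big_mkcond [leRHS]big_mkcond /=.
apply: ler_sum => H _; rewrite finset.sub0set !inE /=; have m0 := gnp_mass_ge0 p01 H.
case: (H \subset K); rewrite ?andbF//= andbT.
case: has_seed; rewrite /= ?andbF ?mulr0// andbT mulr1.
case: ifP => zH; last by rewrite mulr_ge0 ?exprn_ge0.
by rewrite ler_wpM2l// lerXn2r ?nnegrE ?(ltW z0).
Qed.

(** m^m / m! is one term of the series of e^m. *)
Lemma powr_le_fact (m : nat) : m%:R ^+ m <= m`!%:R * expR m%:R :> R.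
Proof.
case: m => [|m]; first by rewrite expr0 fact0 mul1r expR0.
have := @expR_ge1Dxn R m.+1%:R m (ler0n _ _).
move=> h; rewrite mulrC -ler_pdivrMr ?ltr0n ?fact_gt0//.
by apply: le_trans h; rewrite lerDr.
Qed.

(** [card_cores] with V <= 2m / D: the factor n^V is at most exp(2 ln n / D)^m, and C(V^2, m) <=
    V^(2m) / m! <= (4 e m / D^2)^m by [powr_le_fact]. *)
Lemma core_term_le (D L m : nat) : (0 < n)%N -> (0 < D)%N -> (m <= L)%N ->
  #|[set W : edge_set n | [&& W \subset K, is_core D W & #|W| == m]]|%:R * p ^+ m
  <= (expR (2 * ln n%:R / D%:R) * (4 * expR 1 * L%:R / D%:R ^+ 2) * p) ^+ m :> R.
Proof.
move=> n0 D0 mL; set V := ((2 * m) %/ D)%N.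
have mV : (2 * m <= V * D + D.-1)%N.
  by rewrite {1}(divn_eq (2 * m) D) -/V leq_add2l -ltnS prednK// ltn_mod.
rewrite exprMn ler_wpM2r ?exprn_ge0 ?(ltW p_gt0)//.
apply: le_trans (_ : (n ^ V * 'C(V * V, m))%:R <= _); first by rewrite ler_nat card_cores.
have DR : 0 < D%:R :> R by rewrite ltr0n.
have VR : V%:R <= 2 * m%:R / D%:R :> R.
  by rewrite ler_pdivlMr// -natrM -natrM ler_nat leq_divM.
rewrite natrM exprMn; apply: ler_pM; rewrite ?ler0n//.
  rewrite natrX -[n%:R in leLHS]lnK ?posrE ?ltr0n// -!expRM_natl ler_expR.
  have ln0 : 0 <= ln n%:R :> R by rewrite ln_ge0// ler1n.
  have -> : m%:R * (2 * ln n%:R / D%:R) = 2 * m%:R / D%:R * ln n%:R :> R by ring.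
  by rewrite ler_wpM2r.
case: (posnP m) => [->|m0]; first by rewrite bin0 expr0.
have mR : 0 < m%:R :> R by rewrite ltr0n.
rewrite -(@ler_pM2r _ (m`!%:R)) ?ltr0n ?fact_gt0// -natrM bin_ffact.
apply: le_trans (_ : ((V * V) ^ m)%:R <= _); first by rewrite ler_nat leq_ffact_exp.
rewrite natrX natrM.
apply: le_trans (_ : (4 * L%:R / D%:R ^+ 2) ^+ m * m%:R ^+ m <= _).
  rewrite -exprMn lerXn2r ?nnegrE ?mulr_ge0 ?invr_ge0 ?exprn_ge0 ?ler0n//.
  apply: le_trans (_ : (2 * m%:R / D%:R) * (2 * m%:R / D%:R) <= _).
    by apply: ler_pM; rewrite ?ler0n.
  have -> : 2 * m%:R / D%:R * (2 * m%:R / D%:R) = 4 * m%:R / D%:R ^+ 2 * m%:R :> R.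
    by field; rewrite gt_eqF.
  by rewrite !ler_wpM2r ?ler_wpM2l ?invr_ge0 ?exprn_ge0 ?ler0n// ler_nat.
have -> : 4 * expR 1 * L%:R / D%:R ^+ 2 = (4 * L%:R / D%:R ^+ 2) * expR 1 :> R by ring.
rewrite [in leRHS]exprMn -[leRHS]mulrA ler_wpM2l ?exprn_ge0 ?mulr_ge0 ?invr_ge0 ?exprn_ge0 ?ler0n//.
by rewrite -expRM_natl mulr1 mulrC powr_le_fact.
Qed.

(** Here [x] is the triangle threshold for seeds, [y] the bound on S, [s] the net cost of an edge of
    a core and [m0] a lower bound for the size of a core. The factor 3l + 1 counts the possible
    sizes. *)
Lemma upper_tail_le (l D : nat) (x y z s m0 : R) : (0 < n)%N -> (0 < D)%N ->
  0 < z -> 0 <= y -> 0 <= s ->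
  x + n%:R * p * (3 * l)%:R + (n%:R * p) ^+ 3 <= y ->
  expR (2 * ln n%:R / D%:R) * (4 * expR 1 * (3 * l)%:R / D%:R ^+ 2) * p <= expR (- s) ->
  (forall W, W \subset K -> x - (D * (3 * l))%:R <= (triangles W)%:R -> m0 <= #|W|%:R) ->
  gnp p (upper_tail n z) <= (y / z) ^+ l + (3 * l).+1%:R * expR (- (s * m0)).
Proof.
move=> n0 D0 z0 y0 s0 hy hs hm; set L := (3 * l)%N.
pose C : {set edge_set n} := [set W : edge_set n | [&& W \subset K, is_core D W,
  (#|W| <= L)%N & x - (D * L)%:R <= (triangles W)%:R]].
apply: le_trans (_ : gnp p [set H in upper_tail n z | ~~ has_seed L x H] +
    gnp p [set H : edge_set n | [exists (W | W \in C), W \subset H]] <= _).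
  apply: le_trans (gnpU p01 _ _); apply: gnp_mono => // H HK; rewrite !inE => -> /=.
  case: (boolP (has_seed L x H)) => //= /existsP[U /and3P[UH UL xU]].
  have [W [WU cW TW]] := exists_core D (fintype.subset_trans UH HK).
  apply/exists_inP; exists W; last exact: fintype.subset_trans WU UH.
  rewrite inE cW (fintype.subset_trans WU (fintype.subset_trans UH HK)) /=.
  rewrite (leq_trans (subset_leq_card WU) UL) /= lerBlDr -natrD.
  apply: le_trans xU _; rewrite ler_nat; apply: leq_trans TW _.
  by rewrite leq_add2l leq_mul2l UL orbT.
apply: lerD.
  apply: seedless_tail_le => // U UK UL Ux; apply: le_trans (weight_le p01 UK) _.
  apply: le_trans hy; rewrite lerD2r; apply: lerD; first exact: ltW.
  by apply: ler_wpM2l; rewrite ?ler_nat// mulr_ge0// ltW.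
apply: le_trans (gnp_exists p01 _) _; first by move=> W; rewrite inE => /andP[].
pose S m : {set edge_set n} := [set W : edge_set n | [&& W \subset K, is_core D W & #|W| == m]].
apply: le_trans (_ : \sum_(m < L.+1) (if m0 <= m%:R then #|S m|%:R * p ^+ m else 0) <= _).
  have -> : \sum_(W in C) p ^+ #|W| = \sum_(m < L.+1) \sum_(W in C | #|W| == m) p ^+ #|W|.
    rewrite (exchange_big_dep (mem C)) /=; last by move=> ? ? _ /andP[].
    apply: eq_bigr => W WC; have WL : (#|W| < L.+1)%N.
      by move: WC; rewrite inE ltnS => /and4P[].
    rewrite (big_pred1 (Ordinal WL))// => i; rewrite WC /= eq_sym.
    by apply/eqP/eqP => [iE|->//]; apply: val_inj.
  apply: ler_sum => m _; case: ifPn => mm.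
    rewrite mulr_natl -sumr_const big_mkcond [leRHS]big_mkcond /=.
    apply: ler_sum => W _; rewrite !inE.
    case: (W \subset K) => //=; case: (is_core D W) => //=.
    case: eqP => [->|_]; rewrite ?andbF// andbT; case: ifP => // _.
    by rewrite exprn_ge0// ltW.
  rewrite big1// => W /andP[]; rewrite inE => /and4P[WK _ _ xW] /eqP Wm.
  by move: mm; rewrite -Wm hm.
apply: le_trans (_ : \sum_(m < L.+1) expR (- (s * m0)) <= _); last first.
  by rewrite sumr_const card_ord mulr_natl.
apply: ler_sum => m _; case: ifPn => [mm|_]; last exact: expR_ge0.
have mL : (m <= L)%N by rewrite -ltnS.
apply: le_trans (core_term_le n0 D0 mL) _.
apply: le_trans (_ : expR (- s) ^+ m <= _).
  by rewrite lerXn2r// nnegrE ?expR_ge0// !mulr_ge0 ?expR_ge0 ?invr_ge0 ?exprn_ge0// ?ltW.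
by rewrite -expRM_natl ler_expR mulrN lerN2 mulrC ler_wpM2r.
Qed.

End UpperTail.

(** * The minimum Phi *)

Section Cliques.
Variable n : nat.

Lemma triangles_pairs (S : {set 'I_n}) : ('C(#|S|, 3) <= triangles (pairs S))%N.
Proof.
rewrite -cards_draws trianglesE; apply/subset_leq_card/fintype.subsetP => t.
rewrite !inE => /andP[tS ->] /=; apply/fintype.subsetP => e.
by rewrite !inE => /andP[et ->]; rewrite andbT (fintype.subset_trans et tS).
Qed.

(** Take the smallest clique with at least [z] triangles, on m + 1 vertices. By minimality (m - 2)^3
    <= 6 C(m, 3) < 6z = c^3, so m + 1 <= c + 3. *)
Lemma exists_clique (R : realType) (z c : R) : 0 < c -> c ^+ 3 = 6 * z ->
  z <= 'C(n, 3)%:R ->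
  exists G : edge_set n, [/\ G \subset complete_graph n,
    z <= (triangles G)%:R & #|G|%:R <= (c + 3) ^+ 2 / 2].
Proof.
move=> c0 cz zn; have z0 : 0 < z by have := exprn_gt0 3 c0; lra.
have ex : exists m, z <= 'C(m, 3)%:R by exists n.
have [m zm mmin] := ex_minnP ex.
have mn : (m <= n)%N by exact: mmin.
case: m zm mmin mn => [|m] zm mmin mn; first by move: zm; rewrite bin0n leNgt z0.
pose S : {set 'I_n} := [set i : 'I_n | (i < m.+1)%N].
have cS : #|S| = m.+1.
  have winj : injective (widen_ord mn) by move=> i j [] /val_inj.
  rewrite -[RHS](card_ord m.+1) -(card_imset _ winj).
  apply: eq_card => i; rewrite inE; apply/idP/finset.imsetP => [im|[j _ ->]]; last exact: (ltn_ord j).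
  by exists (Ordinal im) => //; apply: val_inj.
exists (pairs S); split; first exact: pairs_complete.
  by apply: le_trans zm _; rewrite ler_nat -cS triangles_pairs.
rewrite card_pairs cS.
have mz : 'C(m, 3)%:R < z by rewrite ltNge; apply/negP => /mmin; rewrite ltnn.
have mc : m.+1%:R <= c + 3.
  (* Small cliques are treated apart, because m - 2 is a truncated subtraction. *)
  case: (leqP m.+1 3) => m3.
    by have : m.+1%:R <= 3 :> R; [rewrite (ler_nat R _ 3)|lra].
  have -> : m.+1 = ((m - 2) + 3)%N by lia.
  rewrite natrD lerD2r -(@ler_pXn2r _ 3)// ?nnegrE ?ler0n// ?(ltW c0)//.
  apply: ltW; rewrite cz; apply: le_lt_trans (_ : 6 * 'C(m, 3)%:R < _); last by lra.
  rewrite -natrX -natrM ler_nat.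
  have -> : (6 * 'C(m, 3) = m ^_ 3)%N by rewrite -bin_ffact mulnC.
  rewrite !ffactnSr ffactn0 mul1n subn0 !expnS expn0 muln1 mulnA.
  by apply: leq_mul => //; apply: leq_mul; lia.
have m0 : 0 <= m.+1%:R :> R by exact: ler0n.
apply: le_trans (_ : m.+1%:R ^+ 2 / 2 <= _); last first.
  by rewrite ler_pM2r// lerXn2r ?nnegrE// addr_ge0// ltW.
rewrite ler_pdivlMr// -natrX -natrM ler_nat bin2 /=.
by nia.
Qed.

(** [triangles_sq] solved for the edges: c^6 <= (6 T)^2 <= (2 |U|)^3. *)
Lemma edges_ge (R : realType) (c : R) (U : edge_set n) :
  U \subset complete_graph n -> 0 <= c -> c ^+ 3 <= 6 * (triangles U)%:R ->
  c ^+ 2 / 2 <= #|U|%:R.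
Proof.
move=> UK c0 cT; have := triangles_sq UK; rewrite -(ler_nat R) natrM natrX natrM natrX => TU.
have e0 : 0 <= #|U|%:R :> R by [].
have T0 : 0 <= (triangles U)%:R :> R by [].
rewrite ler_pdivrMr// -(@ler_pXn2r _ 3)// ?nnegrE ?mulr_ge0 ?exprn_ge0//.
rewrite -exprM mulnC exprM.
apply: le_trans (_ : (6 * (triangles U)%:R) ^+ 2 <= _).
  by rewrite lerXn2r ?nnegrE ?exprn_ge0 ?mulr_ge0.
by rewrite !exprMn; lra.
Qed.

End Cliques.

(** * Bounds on [Phi] by edge counts *)

Section MinEdges.
Variables (R : realType) (n : nat) (p lambda : R).
Hypotheses (p01 : 0 < p < 1) (np : n%:R * p = lambda).
Implicit Types G : edge_set n.

Let Lp_gt0 : 0 < ln p^-1.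
Proof. by case/andP: p01 => p0 p1; rewrite ln_gt0// invf_gt1. Qed.

Let lambda_ge0 : 0 <= lambda.
Proof. by case/andP: p01 => p0 p1; rewrite -np mulr_ge0// ltW. Qed.

Lemma feasibleE (k b : R) G :
  (G \in feasible n p k b) = (G \subset complete_graph n) && (b * k <= weight p G).
Proof. by rewrite inE; case: (boolP (G \subset _)) => //= GK; rewrite cond_mean_weight. Qed.

Lemma feasible_triangles (k b : R) G : G \in feasible n p k b ->
  b * k <= (triangles G)%:R + lambda * #|G|%:R + lambda ^+ 3.
Proof.
rewrite feasibleE => /andP[GK]; move/le_trans; apply.
by rewrite -np; exact: weight_le.
Qed.

Lemma triangles_feasible (k b : R) G : G \subset complete_graph n ->
  b * k <= (triangles G)%:R -> G \in feasible n p k b.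
Proof. by move=> GK bT; rewrite feasibleE GK (le_trans bT)// weight_ge. Qed.

Lemma feasible_bin (k b : R) G : G \in feasible n p k b -> b * k <= 'C(n, 3)%:R.
Proof. by rewrite feasibleE => /andP[_ /le_trans]; apply; exact: weight_le_bin. Qed.

Lemma Phi_le (k b : R) G : G \in feasible n p k b ->
  (Phi n p k b <= (#|G|%:R * ln p^-1)%:E)%E.
Proof. by move=> Gf; apply: (@bigmin_le_cond _ _ _ _ G (mem (feasible n p k b))). Qed.

Lemma Phi_ge (k b x : R) :
  (forall G, G \in feasible n p k b -> x <= #|G|%:R) ->
  ((x * ln p^-1)%:E <= Phi n p k b)%E.
Proof.
move=> xG; apply: le_bigmin => [|G /xG xG']; first exact: leey.
by rewrite lee_fin ler_pM2r.
Qed.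

Lemma Phi_attained (k b : R) G0 : G0 \in feasible n p k b ->
  exists G, [/\ G \in feasible n p k b, Phi n p k b = (#|G|%:R * ln p^-1)%:E &
    forall G', G' \in feasible n p k b -> (#|G| <= #|G'|)%N].
Proof.
move=> G0f.
have [G Gf Gmin] := @arg_minnP _ G0 (fun G => G \in feasible n p k b) (fun G => #|G|) G0f.
exists G; split=> //; apply/eqP; rewrite eq_le Phi_le//=.
by apply: Phi_ge => G' /Gmin; rewrite ler_nat.
Qed.

Lemma Phi_infeasible (k b : R) : (forall G, G \notin feasible n p k b) ->
  Phi n p k b = +oo%E.
Proof. by move=> nf; apply: big1 => G; rewrite (negbTE (nf G)). Qed.

Lemma upper_tail_ge_edges G (z : R) : G \subset complete_graph n ->
  z <= (triangles G)%:R -> p ^+ #|G| <= gnp p (upper_tail n z).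
Proof.
move=> GK zG; rewrite -gnp_contains//; apply: (gnp_mono p01) => H HK; rewrite !inE.
by move=> GH; apply: le_trans zG _; rewrite ler_nat triangles_mono.
Qed.

(* The minimiser of [Phi] at [b > a] itself contains [a * k] triangles, since
   conditioning adds at most [lambda * e_G + lambda ^ 3] to its triangle count. *)
Lemma log_upper_tail_ge (k a b c : R) : 0 < c -> c ^+ 3 = 6 * (b * k) ->
  a * k + lambda * ((c + 3) ^+ 2 / 2) + lambda ^+ 3 <= b * k ->
  (- Phi n p k b <= lne (gnp p (upper_tail n (a * k)))%:E)%E.
Proof.
(* If nothing is feasible at [b], then [Phi] is +oo and the left side is -oo. *)
move=> c0 cb ab; case: (pselect (exists G, G \in feasible n p k b)) => [[G0 G0f]|nf]; last first.
  by rewrite Phi_infeasible ?leNye// => G; apply/negP => Gf; apply: nf; exists G.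
have [G [Gf -> Gmin]] := Phi_attained G0f.
(* This clique is feasible at [b], so the minimiser has no more edges than it; this bounds the term
   [lambda * #|G|]. *)
have [G' [G'K G'T G'e]] := exists_clique c0 cb (feasible_bin G0f).
have Ge : #|G|%:R <= (c + 3) ^+ 2 / 2.
  by apply: le_trans G'e; rewrite ler_nat Gmin// triangles_feasible.
have GK : G \subset complete_graph n by move: Gf; rewrite inE => /andP[].
have GT : a * k <= (triangles G)%:R.
  have := feasible_triangles Gf; have := ler_wpM2l lambda_ge0 Ge; lra.
have := upper_tail_ge_edges GK GT; have p0 : 0 < p by case/andP: p01.
move=> pP; have P0 := lt_le_trans (exprn_gt0 #|G| p0) pP.
rewrite lne_EFin// -EFinN lee_fin lnV ?posrE// mulrN opprK mulr_natl -lnXn//.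
by rewrite ler_ln ?posrE ?exprn_gt0.
Qed.

(** A feasible [G] with fewer than d^2 / 2 edges would still have b k triangles of its own, which
    contradicts [edges_ge]. *)
Lemma Phi_ge_edges (k a b d : R) : 0 <= d -> d ^+ 3 = 6 * (b * k) ->
  b * k + lambda * (d ^+ 2 / 2) + lambda ^+ 3 <= a * k ->
  ((d ^+ 2 / 2 * ln p^-1)%:E <= Phi n p k a)%E.
Proof.
move=> d0 db ba; apply: Phi_ge => G Gf.
have GK : G \subset complete_graph n by move: Gf; rewrite inE => /andP[].
rewrite leNgt; apply/negP => Gd.
have bT : 6 * (b * k) <= 6 * (triangles G)%:R.
  have := feasible_triangles Gf; have := ler_wpM2l lambda_ge0 (ltW Gd); lra.
by have := @edges_ge _ _ d _ GK d0; rewrite db => /(_ bT); rewrite leNgt Gd.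
Qed.

End MinEdges.

(** * Asymptotics *)

(** [upper_tail_le] with z = c^3 / 6, x = (1 - 2 delta) z, y = (1 - delta) z, s = (1 - delta)
    ln(1/p) and m0 = ((1 - 3 delta) c)^2 / 2. The constant [B] depends on [lambda] and [delta]
    only. *)
Lemma upper_tail_expR_le (R : realType) (lambda delta : R) :
  0 <= lambda -> 0 < delta < 1 / 8 ->
  exists B : R, forall (n : nat) (p c : R),
    (0 < n)%N -> 0 < p < 1 -> n%:R * p = lambda ->
    B <= c -> B <= ln p^-1 -> B * ln p^-1 <= c -> ln n%:R <= 2 * ln p^-1 ->
    gnp p (upper_tail n (c ^+ 3 / 6)) <=
      expR (- ((1 - 8 * delta) * (c ^+ 2 * ln p^-1 / 2))).
Proof.
move=> la0 /andP[d0 d1]; pose i := delta^-1.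
have i0 : 0 < i by rewrite invr_gt0.
have di : delta * i = 1 by rewrite mulfV// gt_eqF.
have e0 : 0 < expR 1 :> R by exact: expR_gt0.
pose B1 := 576 * i ^+ 3; pose B2 := 36 * lambda * i ^+ 2; pose B3 := 12 * lambda ^+ 3 * i.
pose Q := 4 * expR 1 * (12 * 18 * 18) * i ^+ 5; pose B4 := 384 * Q * i ^+ 4;
pose B5 := 2 * i * (12 * i ^+ 2 + 2).
have B10 : 0 <= B1 by apply: mulr_ge0; [exact: ler0n | exact: exprn_ge0 (ltW i0)].
have B20 : 0 <= B2 by rewrite /B2 !mulr_ge0 ?exprn_ge0 ?(ltW i0).
have B30 : 0 <= B3 by rewrite /B3 !mulr_ge0 ?exprn_ge0 ?(ltW i0).
have i8 : 8 < i by nra.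
have Q0 : 0 < Q by rewrite /Q !mulr_gt0 ?exprn_gt0.
have B40 : 0 <= B4.
  apply: mulr_ge0; last exact: exprn_ge0 (ltW i0).
  by apply: mulr_ge0 (ltW Q0); exact: ler0n.
have B50 : 0 <= B5.
  by rewrite /B5 !mulr_ge0 ?addr_ge0 ?mulr_ge0 ?exprn_ge0 ?(ltW i0).
(* [B1] makes [D] large, [B2] and [B3] absorb the term [lambda e_U + lambda ^ 3],
   [B4] and [B5] let exponentials of [ln p^-1] beat the polynomial factors. *)
exists (1 + B1 + B2 + B3 + B4 + B5) => n p c n0 p01 np Bc.
set Lp := ln p^-1 => BL BLc lnL.
have p0 : 0 < p by case/andP: p01.
have c1 : 1 <= c by lra.
have L1 : 1 <= Lp by lra.
have c0 : 0 < c by lra.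
have L0 : 0 < Lp by lra.
have cL A : 0 <= A -> A <= 1 + B1 + B2 + B3 + B4 + B5 -> A * Lp <= c.
  by move=> A0 AB; apply: le_trans BLc; rewrite ler_wpM2r// ltW.
have cL1 : 576 * i ^+ 3 * Lp <= c by apply: cL => //; rewrite -/B1; lra.
have cL2 : 36 * lambda * i ^+ 2 * Lp <= c by apply: cL => //; rewrite -/B2; lra.
have cB3 : 12 * lambda ^+ 3 * i <= c by rewrite -/B3; lra.
have LB4 : 384 * Q * i ^+ 4 <= Lp by rewrite -/B4; lra.
have LB5 : 2 * i * (12 * i ^+ 2 + 2) <= Lp by rewrite -/B5; lra.
clear cL; clear Bc BL BLc; clear B10 B20 B30 B40 B50; clear B1 B2 B3 B4 B5.
pose T := c ^+ 2 * Lp / 2.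
have T0 : 0 < T by rewrite /T !mulr_gt0 ?exprn_gt0.
have LT : Lp <= 2 * T.
  rewrite /T mulrC divfK// -[leLHS]mul1r ler_wpM2r ?(ltW L0)//.
  by rewrite exprn_ege1.
(* [T] is the exponent aimed at; as delta l > T, the moment term (1 - delta)^l is below exp(-T). *)
pose l := (Num.truncn (T * i)).+1.
have lgt : T * i < l%:R by exact: truncnS_gt.
have Ti1 : 1 <= T * i by nra.
have lle : l%:R <= 2 * (T * i).
  have : (Num.truncn (T * i))%:R <= T * i by rewrite truncn_le mulr_ge0// ltW.
  by rewrite /l -natr1; lra.
clearbody l.
(* The 18 makes Y * 6 T / delta equal to delta z, so that passing from a seed to its core loses at
   most delta z triangles. *)
pose Y := delta ^+ 2 * c / (18 * Lp).
have Yi : 32 * i <= Y.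
  rewrite ler_pdivlMr; last by lra.
  have := ler_wpM2l (exprn_ge0 2 (ltW d0)) cL1.
  have -> : delta ^+ 2 * (576 * i ^+ 3 * Lp) = (delta * i) ^+ 2 * (576 * i * Lp) by ring.
  by rewrite di; lra.
have Y2 : 2 <= Y by lra.
clear cL1.
pose D := Num.truncn Y.
have DY : D%:R <= Y by rewrite truncn_le; lra.
have YD : Y < D.+1%:R by exact: truncnS_gt.
have D0 : (0 < D)%N by rewrite truncn_gt0; lra.
have DYh : Y / 2 <= D%:R.
  by move: YD; rewrite -natr1; lra.
clearbody D.
pose z := c ^+ 3 / 6.
have z0 : 0 < z by rewrite /z divr_gt0 ?exprn_gt0.
have lR : (3 * l)%:R = 3 * l%:R :> R by rewrite natrM.
have DL : (D * (3 * l))%:R <= delta * z.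
  rewrite natrM lR; apply: le_trans (_ : Y * (3 * (2 * (T * i))) <= _).
    by apply: ler_pM => //; rewrite ler_pM2l.
  suff -> : Y * (3 * (2 * (T * i))) = (delta * i) * (delta * z) by rewrite di mul1r.
  by rewrite /Y /T /z; field; rewrite gt_eqF.
(* The two error terms are each at most delta c^3 / 12, half of delta z. *)
have hy : (1 - 2 * delta) * z + n%:R * p * (3 * l)%:R + (n%:R * p) ^+ 3 <= (1 - delta) * z.
  rewrite np lR.
  have h1 : lambda * (3 * l%:R) <= lambda * (3 * (2 * (T * i))).
    by rewrite ler_wpM2l// ler_pM2l.
  have h2 : lambda * (3 * (2 * (T * i))) <= delta * c ^+ 3 / 12.
    have := ler_wpM2l (mulr_ge0 (ltW d0) (exprn_ge0 2 (ltW c0))) cL2.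
    have -> : delta * c ^+ 2 * (36 * lambda * i ^+ 2 * Lp) =
      12 * (delta * i) * (lambda * (3 * (2 * (T * i)))).
      by rewrite /T; field.
    by rewrite di exprS; lra.
  have h3 : lambda ^+ 3 <= delta * c ^+ 3 / 12.
    have cc : c <= c ^+ 3 by rewrite -[leLHS]expr1 ler_weXn2l.
    have B3c : 12 * lambda ^+ 3 * i <= c ^+ 3 by lra.
    have := ler_wpM2l (ltW d0) B3c.
    have -> : delta * (12 * lambda ^+ 3 * i) = (delta * i) * (12 * lambda ^+ 3) by ring.
    by rewrite di; lra.
  by rewrite /z; lra.
have hs : expR (2 * ln n%:R / D%:R) * (4 * expR 1 * (3 * l)%:R / D%:R ^+ 2) * p
    <= expR (- ((1 - delta) * Lp)).
  have DR : 0 < D%:R :> R by rewrite ltr0n.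
  have -> : p = expR (- Lp) by rewrite /Lp lnV ?posrE// opprK lnK.
  (* The choice of vertices costs delta Lp / 4 per edge and that of edges delta Lp / 2, together
     less than delta Lp. *)
  apply: le_trans (_ : expR (delta * Lp / 4) * expR (delta * Lp / 2) * expR (- Lp) <= _); last first.
    by rewrite -!expRD ler_expR; nra.
  rewrite ler_pM2r ?expR_gt0//; apply: ler_pM; rewrite ?expR_ge0 ?divr_ge0 ?mulr_ge0 ?exprn_ge0 ?(ltW e0)//.
    rewrite ler_expR ler_pdivrMr//; apply: le_trans (_ : delta * Lp / 4 * (16 * i) <= _).
      have -> : delta * Lp / 4 * (16 * i) = (delta * i) * (4 * Lp) by field.
      by rewrite di; lra.
    by rewrite ler_wpM2l ?divr_ge0 ?mulr_ge0 ?(ltW d0) ?(ltW L0)//; lra.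
  (* The powers of [c] cancel in l / D^2, leaving a cubic in [Lp]; the fourth-order term of the
     exponential series beats it. *)
  apply: le_trans (_ : Q * Lp ^+ 3 <= _).
    rewrite ler_pdivrMr ?exprn_gt0//.
    apply: le_trans (_ : Q * Lp ^+ 3 * (Y / 2) ^+ 2 <= _); last first.
      apply: ler_wpM2l; first by rewrite mulr_ge0 ?exprn_ge0 ?(ltW Q0) ?(ltW L0).
      by apply: lerXn2r => //; rewrite nnegrE; lra.
    have -> : Q * Lp ^+ 3 * (Y / 2) ^+ 2 = (delta * i) ^+ 4 * (4 * expR 1 * (3 * (2 * (T * i)))).
      by rewrite /Q /Y /T; field; rewrite gt_eqF.
    by rewrite di expr1n mul1r lR ler_wpM2l ?mulr_ge0 ?(ltW e0)// ler_pM2l.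
  have t0 : 0 <= delta * Lp / 2 by rewrite divr_ge0 ?mulr_ge0 ?(ltW d0) ?(ltW L0).
  apply: le_trans (expR_ge1Dxn 3 t0).
  apply: le_trans (_ : (delta * Lp / 2) ^+ 4 / 4`!%:R <= _); last by rewrite lerDr.
  have := ler_wpM2l (mulr_ge0 (exprn_ge0 4 (ltW d0)) (exprn_ge0 3 (ltW L0))) LB4.
  have -> : delta ^+ 4 * Lp ^+ 3 * (384 * Q * i ^+ 4) = 384 * (delta * i) ^+ 4 * (Q * Lp ^+ 3).
    by ring.
  have -> : (delta * Lp / 2) ^+ 4 / 4`!%:R = delta ^+ 4 * Lp ^+ 3 * Lp / 384.
    by rewrite !factS fact0; field.
  by rewrite di expr1n; lra.
have hm (W : edge_set n) : W \subset complete_graph n ->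
    (1 - 2 * delta) * z - (D * (3 * l))%:R <= (triangles W)%:R ->
    ((1 - 3 * delta) * c) ^+ 2 / 2 <= #|W|%:R.
  move=> WK WT; apply: edges_ge WK _ _; first by rewrite mulr_ge0; lra.
  have d3 : 0 <= 1 - 3 * delta <= 1 by apply/andP; split; lra.
  apply: le_trans (_ : (1 - 3 * delta) * c ^+ 3 <= _); last by move: WT DL; rewrite /z; lra.
  rewrite exprMn ler_wpM2r ?exprn_ge0 ?(ltW c0)// exprS -[leRHS]mulr1.
  by case/andP: d3 => d30 d31; rewrite ler_wpM2l// exprn_ile1.
clear cL2 cB3 LB4 DL.
have s0 : 0 <= (1 - delta) * Lp by rewrite mulr_ge0; lra.
have y0 : 0 <= (1 - delta) * z by rewrite mulr_ge0; lra.
apply: le_trans (upper_tail_le p01 n0 D0 z0 y0 s0 hy hs hm) _.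
rewrite mulfK ?gt_eqF// -/T.
have main : (1 - delta) ^+ l + (3 * l).+1%:R *
    expR (- ((1 - delta) * Lp * (((1 - 3 * delta) * c) ^+ 2 / 2)))
    <= (6 * (T * i) + 2) * expR (- ((1 - 7 * delta) * T)).
  have h1 : (1 - delta) ^+ l <= expR (- ((1 - 7 * delta) * T)).
    apply: le_trans (_ : expR (- delta) ^+ l <= _).
      by rewrite lerXn2r ?nnegrE ?expR_ge0 ?expR_ge1Dx//; lra.
    rewrite -expRM_natl ler_expR.
    have := ler_wpM2l (ltW d0) (ltW lgt).
    have -> : delta * (T * i) = (delta * i) * T by ring.
    by rewrite di; nra.
  have h2 : expR (- ((1 - delta) * Lp * (((1 - 3 * delta) * c) ^+ 2 / 2)))
      <= expR (- ((1 - 7 * delta) * T)).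
    rewrite ler_expR lerN2.
    have -> : (1 - delta) * Lp * (((1 - 3 * delta) * c) ^+ 2 / 2) =
      (1 - delta) * (1 - 3 * delta) ^+ 2 * T by rewrite /T; field.
    by rewrite ler_wpM2r ?(ltW T0)//; nra.
  have h3 : (3 * l).+1%:R <= 6 * (T * i) + 1 by rewrite -natr1 lR; lra.
  have := ler_pM (ler0n _ _) (expR_ge0 _) h3 h2; lra.
apply: le_trans main _.
(* The last delta T of the exponent pays for the factor linear in [T]. *)
have -> : - ((1 - 8 * delta) * T) = delta * T + - ((1 - 7 * delta) * T) by ring.
rewrite expRD ler_pM2r ?expR_gt0//.
have t0 : 0 <= delta * T by rewrite mulr_ge0// ltW.
apply: le_trans (expR_ge1Dxn 1 t0).
have -> : T * i = (delta * i) * (T * i) by rewrite di mul1r.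
have -> : delta * i * (T * i) = (delta * T) * i ^+ 2 by ring.
have tB : 12 * i ^+ 2 + 2 <= delta * T.
  have BT : 2 * i * (12 * i ^+ 2 + 2) <= 2 * T by lra.
  have := ler_wpM2l (ltW d0) BT.
  have -> : delta * (2 * i * (12 * i ^+ 2 + 2)) = (delta * i) * (2 * (12 * i ^+ 2 + 2)) by ring.
  by rewrite di; lra.
have -> : 2`!%:R = 2 :> R by [].
have := ler_wpM2l t0 tB; have := exprn_ge0 2 (ltW i0); rewrite expr2; nra.
Qed.

Lemma powR_third_cube (R : realType) (x : R) : 0 <= x -> (x `^ (1 / 3)) ^+ 3 = x.
Proof. by move=> x0; rewrite -powR_mulrn ?powR_ge0// -powRrM divfK ?powRr1. Qed.

Lemma powR_two_thirds (R : realType) (x : R) : x `^ (2 / 3) = (x `^ (1 / 3)) ^+ 2.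
Proof. by rewrite -powR_mulrn ?powR_ge0// -powRrM; congr powR; field. Qed.

(** * Bounds for one [n], with c = (6 a k)^(1/3) *)

Section RegimeBounds.
Variables (R : realType) (lambda a : R).
Hypotheses (lambda_gt0 : 0 < lambda) (a_gt0 : 0 < a).
Variables (n : nat) (p k w c : R).
Hypothesis p01 : 0 < p < 1.
Hypothesis np : n%:R * p = lambda.
Hypothesis k_gt0 : 0 < k.
Hypothesis w_gt0 : 0 < w.
Hypothesis c_ge1 : 1 <= c.
Hypothesis cE : c ^+ 3 = 6 * (a * k).

Let Lp_gt0 : 0 < ln p^-1.
Proof. by case/andP: p01 => p0 p1; rewrite ln_gt0// invf_gt1. Qed.

Let c_gt0 : 0 < c. Proof. exact: lt_le_trans ltr01 c_ge1. Qed.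

(** As c^3 = 6 a k, the slack a w k has order w c^3; once w c is large it absorbs errors of order
    c^2, such as [lambda * #|G|]. *)
Let cubeE (B : R) : B <= w * c -> B * c ^+ 2 <= 6 * (a * (w * k)).
Proof.
move=> Bw; have := ler_wpM2r (exprn_ge0 2 (ltW c_gt0)) Bw.
have -> : w * c * c ^+ 2 = w * c ^+ 3 by ring.
by rewrite cE; lra.
Qed.

Let c2_ge1 : 1 <= c ^+ 2. Proof. exact: exprn_ege1. Qed.

Lemma Phi_ge0 b : (0 <= Phi n p k b)%E.
Proof.
have -> : 0%E = (0 * ln p^-1)%:E by rewrite mul0r.
by apply: (@Phi_ge _ _ _ p01 k b 0) => G _; exact: ler0n.
Qed.

Lemma log_upper_tail_ge_regime (eps : R) : 0 <= eps -> w <= a ->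
  6 * a * (13 * lambda + lambda ^+ 3) <= w * c ->
  (- ((1 + eps)%:E * Phi n p k (a + w)) <= lne (gnp p (upper_tail n (a * k)))%:E)%E.
Proof.
have [c1 c0 c21] : [/\ 1 <= c, 0 < c & 1 <= c ^+ 2] by []; have [w0 a0] : 0 < w /\ 0 < a by [].
move=> eps0 wa Bw; pose d := (6 * ((a + w) * k)) `^ (1 / 3).
have x0 : 0 < 6 * ((a + w) * k) by rewrite !mulr_gt0// addr_gt0.
have dE : d ^+ 3 = 6 * ((a + w) * k) by exact: powR_third_cube (ltW x0).
have d0 : 0 < d by exact: powR_gt0.
have d2c : d <= 2 * c.
  rewrite -(@ler_pXn2r _ 3)// ?nnegrE ?mulr_ge0 ?(ltW d0) ?(ltW c_gt0)//.
  rewrite dE exprMn cE.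
  have : w * k <= a * k by rewrite ler_pM2r.
  have := mulr_gt0 a_gt0 k_gt0; lra.
apply: le_trans (log_upper_tail_ge p01 np d0 dE _).
  by rewrite leeN2; apply: lee_pemull; rewrite ?Phi_ge0// lee_fin; lra.
have l3 : 0 <= lambda ^+ 3 by rewrite exprn_ge0// ltW.
(* d + 3 <= 5c, and 25 / 2 <= 13. *)
have h1 : (d + 3) ^+ 2 / 2 <= 13 * c ^+ 2.
  have : (d + 3) ^+ 2 <= (5 * c) ^+ 2.
    by rewrite lerXn2r ?nnegrE ?mulr_ge0 ?addr_ge0 ?(ltW d0) ?(ltW c_gt0)//; lra.
  by rewrite exprMn; lra.
have h2 := ler_wpM2l (ltW lambda_gt0) h1.
have h3 := ler_wpM2l l3 c2_ge1.
have := cubeE Bw.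
have -> : 6 * a * (13 * lambda + lambda ^+ 3) * c ^+ 2 =
  6 * (a * (lambda * (13 * c ^+ 2) + lambda ^+ 3 * c ^+ 2)) by ring.
rewrite ler_pM2l// ler_pM2l// => h4; rewrite mulrDl; lra.
Qed.

Lemma Phi_ge_regime : w <= 1 -> 6 * (lambda + lambda ^+ 3) <= w * c ->
  ((1 / 2 * (6 * a * (1 - w) * k) `^ (2 / 3) * ln p^-1)%:E <= Phi n p k a)%E.
Proof.
have [c1 c0 c21] : [/\ 1 <= c, 0 < c & 1 <= c ^+ 2] by []; have [w0 a0] : 0 < w /\ 0 < a by [].
move=> w1 Bw; pose x := 6 * (a * (1 - w) * k).
have x0 : 0 <= x by rewrite /x !mulr_ge0 ?subr_ge0 ?(ltW a_gt0) ?(ltW k_gt0).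
have -> : 6 * a * (1 - w) * k = x by rewrite /x; ring.
pose d := x `^ (1 / 3); have dE : d ^+ 3 = x by exact: powR_third_cube.
have d0 : 0 <= d by exact: powR_ge0.
rewrite powR_two_thirds -/d.
have -> : 1 / 2 * d ^+ 2 * ln p^-1 = d ^+ 2 / 2 * ln p^-1 by ring.
apply: (@Phi_ge_edges _ _ _ _ p01 np k a (a * (1 - w))) => //.
have dc : d <= c.
  rewrite -(@ler_pXn2r _ 3)// ?nnegrE ?(ltW c_gt0)// dE cE /x.
  by have := mulr_gt0 w_gt0 (mulr_gt0 a_gt0 k_gt0); lra.
have h1 : d ^+ 2 <= c ^+ 2 by rewrite lerXn2r ?nnegrE ?(ltW c_gt0).
have l3 : 0 <= lambda ^+ 3 by rewrite exprn_ge0// ltW.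
have := ler_wpM2l (ltW lambda_gt0) h1; have := ler_wpM2l l3 c2_ge1.
have := mulr_ge0 (ltW lambda_gt0) (exprn_ge0 2 (ltW c_gt0)).
have := cubeE Bw; lra.
Qed.

Lemma Phi_le_regime G : 63 <= w * c -> G \in feasible n p k a ->
  (Phi n p k a <= (1 / 2 * (6 * a * (1 + w) * k) `^ (2 / 3) * ln p^-1)%:E)%E.
Proof.
have [c1 c0 c21] : [/\ 1 <= c, 0 < c & 1 <= c ^+ 2] by []; have [w0 a0] : 0 < w /\ 0 < a by [].
move=> Bw Gf; have [H [HK HT He]] := exists_clique c_gt0 cE (feasible_bin p01 Gf).
apply: le_trans (Phi_le (triangles_feasible p01 HK HT)) _; rewrite lee_fin ler_pM2r//.
apply: le_trans He _; pose x := 6 * (a * (1 + w) * k).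
have x0 : 0 <= x by rewrite /x !mulr_ge0 ?addr_ge0 ?(ltW a_gt0) ?(ltW k_gt0) ?(ltW w_gt0).
have -> : 6 * a * (1 + w) * k = x by rewrite /x; ring.
pose d := x `^ (1 / 3); have dE : d ^+ 3 = x by exact: powR_third_cube.
have d0 : 0 <= d by exact: powR_ge0.
rewrite powR_two_thirds -/d.
suff cd : c + 3 <= d.
  by have : (c + 3) ^+ 2 <= d ^+ 2; [rewrite lerXn2r ?nnegrE//; lra | lra].
rewrite -(@ler_pXn2r _ 3)// ?nnegrE//; last by lra.
(* As c >= 1, the lower terms sum to at most (9 + 27 + 27) c^2 = 63 c^2. *)
have := cubeE Bw; have -> : (c + 3) ^+ 3 = c ^+ 3 + 9 * c ^+ 2 + 27 * c + 27 by ring.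
have : c <= c ^+ 2 by rewrite -[leLHS]expr1 ler_weXn2l.
by rewrite dE cE /x; lra.
Qed.

(** A positive probability forces a k <= C(n, 3), so that [K_n] has room for the clique and [Phi] is
    finite. *)
Lemma Phi_le_of_tail_gt0 (b : R) : 0 <= b -> b <= a ->
  0 < gnp p (upper_tail n (a * k)) ->
  (Phi n p k b <= ((c + 3) ^+ 2 / 2 * ln p^-1)%:E)%E.
Proof.
have [c1 c0 c21] : [/\ 1 <= c, 0 < c & 1 <= c ^+ 2] by []; have a0 := a_gt0.
move=> b0 ba P0; have zn : a * k <= 'C(n, 3)%:R.
  rewrite leNgt; apply/negP => zn; move: P0; rewrite /gnp big1 ?ltxx// => H.
  rewrite inE => /andP[zH HK]; move: zH; rewrite leNgt (le_lt_trans _ zn)//.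
  by rewrite ler_nat triangles_le_bin.
have [H [HK HT He]] := exists_clique c_gt0 cE zn.
have Hf : H \in feasible n p k b.
  by apply: triangles_feasible => //; apply: le_trans HT; rewrite ler_pM2r.
by apply: le_trans (Phi_le Hf) _; rewrite lee_fin ler_pM2r.
Qed.

(** A crude positive lower bound, which permits division by [Phi]; [b'] is chosen so that d = 1 in
    [Phi_ge_edges]. *)
Lemma Phi_ge_half (b : R) : a / 2 <= b -> 12 * (1 / 6 + lambda + lambda ^+ 3) <= c ->
  ((1 / 2 * ln p^-1)%:E <= Phi n p k b)%E.
Proof.
have [c1 c0 c21] : [/\ 1 <= c, 0 < c & 1 <= c ^+ 2] by []; have a0 := a_gt0.
move=> ab Bc; pose b' := (6 * k)^-1.
have -> : 1 / 2 = 1 ^+ 2 / 2 :> R by rewrite expr1n.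
apply: (@Phi_ge_edges _ _ _ _ p01 np k b b') => //.
  by rewrite /b'; field; rewrite gt_eqF.
have -> : b' * k = 1 / 6 by rewrite /b'; field; rewrite gt_eqF.
have : a / 2 * k <= b * k by rewrite ler_pM2r.
have : c <= c ^+ 3 by rewrite -[leLHS]expr1 ler_weXn2l.
by have := lambda_gt0; rewrite cE expr1n; lra.
Qed.

End RegimeBounds.

Local Open Scope classical_set_scope.

(** * From the limit hypotheses to inequalities for large [n] *)

Section Regime.
Variables (R : realType) (lambda a : R).
Hypotheses (lambda_gt0 : 0 < lambda) (a_gt0 : 0 < a).
Variables (p k w : nat -> R).
Hypothesis pE : forall n, p n = lambda / n%:R.
Hypothesis k_gt0 : forall n, (0 < n)%N -> 0 < k n.
Hypothesis w_gt0 : forall n, (0 < n)%N -> 0 < w n.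
Hypothesis w_cvg : w n @[n --> \oo] --> (0 : R).
Hypothesis w_log : ln n%:R / (w n ^+ 2 * k n `^ (1 / 3)) @[n --> \oo] --> (0 : R).

(** The number c of the overview: roughly the number of vertices of a clique with a k triangles. *)
Definition side n : R := (6 * (a * k n)) `^ (1 / 3).

Definition regime (B : R) n : Prop :=
  [/\ [/\ (0 < n)%N, 0 < p n < 1, n%:R * p n = lambda & side n ^+ 3 = 6 * (a * k n)],
      [/\ B <= side n, B <= ln (p n)^-1, B * ln (p n)^-1 <= side n
        & ln n%:R <= 2 * ln (p n)^-1],
      0 < w n, w n * B <= 1 & B <= w n * side n].

Lemma ln_near_ge (A : R) : \forall n \near \oo, A <= ln n%:R.
Proof.
near=> n; have n1 : expR A <= n%:R by near: n; exact: nbhs_infty_ger.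
by rewrite -(expRK A) ler_ln ?posrE ?expR_gt0// (lt_le_trans (expR_gt0 A)).
Unshelve. all: by end_near. Qed.

(** For large [n], [w_log] makes ln n at most a small multiple of w^2 k^(1/3), hence of w k^(1/3)
    and of k^(1/3), since w <= 1; and ln(1/p) differs from ln n by the constant ln lambda. *)
Lemma regime_near (B : R) : 1 <= B -> \forall n \near \oo, regime B n.
Proof.
move=> B1; have B0 : 0 < B by lra.
pose g := (6 * a) `^ (1 / 3); have g0 : 0 < g by apply: powR_gt0; rewrite mulr_gt0.
(* The bound [g] gives ln n <= w * side, and [g / (2 * B)] gives 2 B ln n <= side. *)
have h0 : 0 < Num.min g (g / (2 * B)) by rewrite lt_min g0 divr_gt0 ?mulr_gt0.
have iB0 : 0 < B^-1 by rewrite invr_gt0.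
have near_w : \forall n \near \oo, w n < B^-1 by exact: cvgr_lt w_cvg _ iB0.
have near_l : \forall n \near \oo, ln n%:R / (w n ^+ 2 * k n `^ (1 / 3)) < Num.min g (g / (2 * B)).
  exact: cvgr_lt w_log _ h0.
near=> n.
have n0 : (0 < n)%N by near: n; exists 1%N.
have nR : 0 < n%:R :> R by rewrite ltr0n.
have k0 := k_gt0 n0; have w0 := w_gt0 n0.
have lnn : 1 + B + 2 * `|ln lambda| <= ln n%:R by near: n; exact: ln_near_ge.
have ln0 : 0 <= `|ln lambda| by [].
have [lm lp] : ln lambda <= `|ln lambda| /\ - ln lambda <= `|ln lambda|.
  by split; [exact: ler_norm | rewrite -normrN; exact: ler_norm].
have LE : ln (p n)^-1 = ln n%:R - ln lambda.
  by rewrite pE invf_div ln_div.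
have wB : w n <= B^-1.
  by apply: ltW; near: n.
have w1 : w n <= 1 by apply: le_trans wB _; rewrite invf_le1.
have wl0 : ln n%:R / (w n ^+ 2 * k n `^ (1 / 3)) < Num.min g (g / (2 * B)).
  by near: n.
pose K := k n `^ (1 / 3); have K0 : 0 < K by rewrite powR_gt0.
have sE : side n = g * K by rewrite /side mulrA powRM ?mulr_ge0 ?(ltW k0) ?(ltW a_gt0).
have wl : ln n%:R <= Num.min g (g / (2 * B)) * (w n ^+ 2 * K).
  rewrite -ler_pdivrMr ?mulr_gt0 ?exprn_gt0//.
  exact: ltW.
have wK : w n ^+ 2 * K <= w n * K.
  by rewrite ler_pM2r// expr2 ler_piMr// ltW.
have wK' : w n * K <= K by rewrite ler_piMl// ltW.
have wK2 : 0 <= w n ^+ 2 * K by rewrite mulr_ge0 ?exprn_ge0 ?(ltW w0) ?(ltW K0).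
have wl1 : ln n%:R <= g * (w n * K).
  apply: le_trans wl _; apply: ler_pM; rewrite ?(ltW h0)//.
  by rewrite ge_min lexx.
have wl2 : ln n%:R <= g / (2 * B) * K.
  apply: le_trans wl _; apply: ler_pM; rewrite ?(ltW h0)//.
    by rewrite ge_min lexx orbT.
  by apply: le_trans wK _.
have ws : w n * side n = g * (w n * K) by rewrite sE; ring.
have wside : w n * side n <= side n.
  by rewrite ws sE; apply: ler_wpM2l => //; exact: ltW.
have p0 : 0 < p n by rewrite pE divr_gt0.
split=> //.
- split=> //.
  + rewrite p0 /=; have : 0 < ln (p n)^-1 by rewrite LE; lra.
    by rewrite lnV ?posrE// oppr_gt0; apply: contraTT; rewrite -!leNgt; exact: ln_ge0.
  + by rewrite pE mulrC divfK// gt_eqF.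
  + by rewrite powR_third_cube// !mulr_ge0// ltW.
- split.
  + by apply: le_trans wside; rewrite ws; apply: le_trans wl1; lra.
  + by rewrite LE; lra.
  + rewrite LE; apply: le_trans (_ : B * (2 * ln n%:R) <= _); first by rewrite ler_pM2l//; lra.
    have := ler_wpM2l (ltW B0) wl2; rewrite sE.
    have -> : B * (g / (2 * B) * K) = g * K / 2 by field; rewrite gt_eqF.
    lra.
  + by rewrite LE; lra.
- by rewrite -ler_pdivlMr// mul1r.
- by rewrite ws; apply: le_trans wl1; lra.
Unshelve. all: by end_near. Qed.

End Regime.

(** The exponent of [upper_tail_expR_le] is compared with the clique bound on [Phi] at a - w; of the
    nine parts [h] of [delta], eight go to the tail and one to (c + 3)^2 <= (1 + h) c^2. *)
Lemma log_upper_tail_le_near (R : realType) (lambda a delta : R) (p k w : nat -> R) :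
  0 < lambda -> 0 < a -> 0 < delta <= 1 ->
  exists2 B : R, 1 <= B & forall n, regime lambda a p k w B n -> 0 < k n ->
    0 < gnp (p n) (upper_tail n (a * k n)) ->
    exists2 f : R, Phi n (p n) (k n) (a - w n) = f%:E &
      0 < f /\ ln (gnp (p n) (upper_tail n (a * k n))) <= - ((1 - delta) * f).
Proof.
move=> la0 a0 /andP[d0 d1]; pose h := delta / 9.
have h0 : 0 < h by rewrite /h divr_gt0.
have h8 : 0 < h < 1 / 8 by rewrite h0 /h /=; lra.
have [Bt tailB] := upper_tail_expR_le (ltW la0) h8.
have l3 : 0 < lambda ^+ 3 by rewrite exprn_gt0.
have a2 : 0 < 2 / a by rewrite divr_gt0.
have ih0 : 0 < 15 / h by rewrite divr_gt0.
have Bt0 := normr_ge0 Bt; have Btn := ler_norm Bt.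
(* 15 / h gives 6c + 9 <= 15c <= h c^2, 2 / a gives w <= a / 2, and the last term serves
   [Phi_ge_half]. *)
pose B := 1 + `|Bt| + 15 / h + 2 / a + 12 * (1 / 6 + lambda + lambda ^+ 3).
have B1 : 1 <= B by rewrite /B; lra.
have BBt : Bt <= B by rewrite /B; lra.
have Bh : 15 / h <= B by rewrite /B; lra.
have Ba : 2 / a <= B by rewrite /B; lra.
have Bl : 12 * (1 / 6 + lambda + lambda ^+ 3) <= B by rewrite /B; lra.
clearbody B.
exists B => // n [[n0 p01 np cE] [Bc BL BLc lnL] w0 wB Bwc] k0 P0.
move: Bc BLc Bwc cE; set c := side a k n => Bc BLc Bwc cE.
set Lp := ln (p n)^-1 in BL BLc lnL; set P := gnp _ _ in P0 *.
have L0 : 0 < Lp by lra.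
have c1 : 1 <= c by lra.
have wa : w n <= a / 2.
  have : w n * (2 / a) <= 1 by apply: le_trans wB; rewrite ler_wpM2l// ltW.
  by rewrite mulrA ler_pdivrMr//; lra.
have lb : ((1 / 2 * Lp)%:E <= Phi n (p n) (k n) (a - w n))%E.
  by apply: (Phi_ge_half la0 a0 p01 np k0 c1 cE) => //; lra.
have ub : (Phi n (p n) (k n) (a - w n) <= ((c + 3) ^+ 2 / 2 * Lp)%:E)%E.
  by apply: (Phi_le_of_tail_gt0 a0 p01 k0 c1 cE) => //; lra.
case: (Phi n (p n) (k n) (a - w n)) lb ub => [f| |] //; rewrite !lee_fin => lb ub.
exists f => //; split; first by lra.
have tail : P <= expR (- ((1 - 8 * h) * (c ^+ 2 * Lp / 2))).
  have -> : P = gnp (p n) (upper_tail n (c ^+ 3 / 6)).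
    by rewrite /P cE; congr (gnp _ (upper_tail _ _)); field.
  have [tc tL] : Bt <= c /\ Bt <= Lp by split; lra.
  by apply: tailB => //; apply: le_trans BLc; rewrite ler_wpM2r// ltW.
apply: le_trans (_ : - ((1 - 8 * h) * (c ^+ 2 * Lp / 2)) <= _).
  by rewrite -[leRHS]expRK ler_ln ?posrE ?expR_gt0.
rewrite lerN2; have dh : delta = 9 * h by rewrite /h; field.
apply: le_trans (_ : (1 - delta) * ((c + 3) ^+ 2 / 2 * Lp) <= _).
  by rewrite ler_wpM2l// subr_ge0.
have ch : 15 <= h * c.
  by rewrite mulrC -ler_pdivrMr//; lra.
have hc : (c + 3) ^+ 2 <= (1 + h) * c ^+ 2 by nra.
have -> : (1 - 8 * h) * (c ^+ 2 * Lp / 2) = (1 - 8 * h) * c ^+ 2 * (Lp / 2) by ring.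
have -> : (1 - delta) * ((c + 3) ^+ 2 / 2 * Lp) = (1 - delta) * (c + 3) ^+ 2 * (Lp / 2) by ring.
rewrite ler_wpM2r//; first by lra.
apply: le_trans (_ : (1 - delta) * ((1 + h) * c ^+ 2) <= _).
  by rewrite ler_wpM2l// subr_ge0.
rewrite mulrA ler_wpM2r ?exprn_ge0//; first by lra.
rewrite dh; nra.
Qed.

(** [lne] is -oo at 0, and [Phi] is +oo when no edge set is feasible; hence the upper bound on [Phi]
    is stated for a nonempty feasible set. *)
Theorem theorem1p2 (R : realType) (lambda a : R)
  (lambda_gt0 : 0 < lambda) (a_gt0 : 0 < a)
  (p : nat -> R) (pE : forall n, p n = lambda / n%:R)
  (k : nat -> R) (k_gt0 : forall n, (0 < n)%N -> 0 < k n)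
  (k_cvg : k n @[n --> \oo] --> +oo)
  (eps : nat -> R) (epsE : forall n, eps n = k n `^ (- (2 / 3)))
  (eps_cvg : eps n @[n --> \oo] --> (0 : R))
  (w : nat -> R) (w_gt0 : forall n, (0 < n)%N -> 0 < w n)
  (w_cvg : w n @[n --> \oo] --> (0 : R))
  (w_lower : exists2 C : R, 0 < C &
     forall n, (0 < n)%N -> 'C(n, 3)%:R * p n `^ C <= w n * k n)
  (w_log : ln n%:R / (w n ^+ 2 * k n `^ (1 / 3)) @[n --> \oo] --> (0 : R))
  (w_log_p : ln (w n) / ln (p n)^-1 @[n --> \oo] --> (0 : R)) :
  (exists2 psi : nat -> R, psi n @[n --> \oo] --> (0 : R) &
    \forall n \near \oo,
      (- ((1 + eps n)%:E * Phi n (p n) (k n) (a + w n))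
         <= lne (gnp (p n) (upper_tail n (a * k n)))%:E)%E /\
      (lne (gnp (p n) (upper_tail n (a * k n)))%:E
         <= - ((1 - psi n)%:E * Phi n (p n) (k n) (a - w n)))%E) /\
  (w n * k n `^ (1 / 3) @[n --> \oo] --> +oo ->
    \forall n \near \oo,
      ((1 / 2 * (6 * a * (1 - w n) * k n) `^ (2 / 3) * ln (p n)^-1)%:E
         <= Phi n (p n) (k n) a)%E /\
      ((exists G : edge_set n, G \in feasible n (p n) (k n) a) ->
       (Phi n (p n) (k n) a
         <= (1 / 2 * (6 * a * (1 + w n) * k n) `^ (2 / 3) * ln (p n)^-1)%:E)%E)).
Proof.
have near_regime := regime_near lambda_gt0 a_gt0 pE k_gt0 w_gt0 w_cvg w_log.
have l3 : 0 < lambda ^+ 3 by rewrite exprn_gt0.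
split; last first.
  move=> _; have B1 : 1 <= 64 + 6 * (lambda + lambda ^+ 3) by lra.
  apply: filterS (near_regime _ B1) => n [[n0 p01 np cE] [Bc BL BLc lnL] w0 wB Bwc].
  have k0 := k_gt0 n n0; have c1 : 1 <= side a k n by lra.
  split.
    by apply: (Phi_ge_regime lambda_gt0 a_gt0 p01 np k0 w0 c1 cE); nra.
  move=> [G Gf].
  by apply: (Phi_le_regime a_gt0 p01 k0 w0 c1 cE _ Gf); lra.
pose P n := gnp (p n) (upper_tail n (a * k n)).
(* The least nonnegative value for which the upper bound holds; when [P n] is 0 the logarithm is -oo
   and 0 will do. *)
pose psi n := if P n == 0 then 0 else
  Num.max 0 (1 + ln (P n) / fine (Phi n (p n) (k n) (a - w n))).
have psi_cvg : psi n @[n --> \oo] --> (0 : R).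
  apply/cvgrPdist_le => e e0.
  have d01 : 0 < Num.min e 1 <= 1 by rewrite lt_min e0 ltr01 ge_min lexx orbT.
  have [B B1 tailB] := log_upper_tail_le_near p k w lambda_gt0 a_gt0 d01.
  apply: filterS (near_regime _ B1) => n reg.
  have n0 : (0 < n)%N by case: reg => -[].
  rewrite sub0r normrN /psi; case: eqP => [_|/eqP P0]; first by rewrite normr0 ltW.
  have p01 : 0 < p n < 1 by case: reg => -[].
  have Pgt0 : 0 < P n by rewrite lt_neqAle eq_sym P0 gnp_ge0.
  have [f -> [f0 fP]] := tailB n reg (k_gt0 n n0) Pgt0.
  rewrite ger0_norm ?le_max ?lexx// ge_max (ltW e0) /=.
  apply: le_trans (_ : Num.min e 1 <= _); last by rewrite ge_min lexx.
  by rewrite -lerBrDl ler_pdivrMr//; apply: le_trans fP _; rewrite -mulNr opprB.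
exists psi => //.
(* Here [tailB] only supplies that [Phi] at a - w is finite and positive. *)
have d01 : 0 < (1 : R) <= 1 by rewrite ltr01 /=.
have [B B1 tailB] := log_upper_tail_le_near p k w lambda_gt0 a_gt0 d01.
have ia0 : 0 < a^-1 by rewrite invr_gt0.
pose B' := B + a^-1 + 6 * a * (13 * lambda + lambda ^+ 3).
have al : 0 < 6 * a * (13 * lambda + lambda ^+ 3) by rewrite !mulr_gt0//; lra.
have B'1 : 1 <= B' by rewrite /B'; lra.
have near_B := near_regime _ B1.
apply: filterS2 near_B (near_regime _ B'1) => n reg.
move=> [[n0 p01 np cE] [Bc BL BLc lnL] w0 wB Bwc].
have k0 := k_gt0 n n0; have c1 : 1 <= side a k n by lra.
split.
  apply: (log_upper_tail_ge_regime lambda_gt0 a_gt0 p01 np k0 w0 c1 cE).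
  - by rewrite epsE powR_ge0.
  - have : w n * a^-1 <= 1.
      by apply: le_trans wB; rewrite ler_wpM2l ?(ltW w0)// /B'; lra.
    by rewrite ler_pdivrMr// mul1r.
  - by apply: le_trans Bwc; rewrite /B'; lra.
rewrite -/(P n) /psi; case: eqP => [->|/eqP P0].
  by rewrite le0_lneNy ?lexx// leNye.
have Pgt0 : 0 < P n by rewrite lt_neqAle eq_sym P0 gnp_ge0.
have [f -> [f0 _]] := tailB n reg k0 Pgt0.
rewrite lne_EFin// -EFinM -EFinN lee_fin /=.
set m := Num.max _ _; have : 1 + ln (P n) / f <= m by rewrite le_max lexx orbT.
by rewrite -lerBrDl ler_pdivrMr// -mulNr opprB.
Qed.
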